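(* For every $n\ge 1$, with $w_\circ$ the longest element of $S_n$, $$\mathfrak G^q_{w_\circ}(x,y)=\sum_{w\in S_n}\mathfrak H_w\,\mathfrak G^q_{ww_\circ}(y),$$ where $\mathfrak H_w=\mathfrak H_w(x)$ is the dual Grothendieck polynomial in the $x$ variables and $\mathfrak G^q_{ww_\circ}(y)$ is the quantum Grothendieck polynomial in the $y$ variables.
   Context: Permutations are composed as functions; $\ell$ is length; $\ge$ on $S_n$ is the Bruhat order; $w_\circ=(n,n-1,\ldots,1)$ in one-line notation. Grothendieck polynomials: $\partial_i=\frac{1-s_i}{x_i-x_{i+1}}$ ($s_i$ exchanging $x_i,x_{i+1}$), $\pi_i=1+(1-x_i)\partial_i$, $\pi_u=\pi_{i_1}\cdots\pi_{i_l}$ for a reduced decomposition $u=s_{i_1}\cdots s_{i_l}$ (well defined). For $w\in S_n$: $\mathfrak G_{w_\circ}=\prod_{i=1}^{n-1}x_i^{n-i}$ and $\mathfrak G_w=\pi_{w^{-1}w_\circ}\mathfrak G_{w_\circ}$. Dual Grothendieck polynomials (depending on $n$): for $w\in S_n$, $\mathfrak H_w=\sum_{v\in S_n,\,v\ge w}(-1)^{\ell(v)-\ell(w)}\mathfrak G_v$. Quantum Grothendieck polynomials: let $e_p^k=e_p(x_1,\ldots,x_k)$ be the elementary symmetric polynomial. For $0\le p\le k$ let $F_0^k=1$ and, for $p\ge1$, $$F_p^k=\sum_{I\subseteq\{1,\ldots,k\},\,|I|=p}\ \prod_{i\in I}(1-x_i)\prod_{i\in I,\ i+1\notin I}(1-q_i),\qquad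 \widehat E_p^k=\sum_{i=0}^p(-1)^i\binom{k-i}{p-i}F_i^k .$$ Let $L_n$ be the $\mathbb Z$-span of the monomials $x_1^{i_1}\cdots x_{n-1}^{i_{n-1}}$ with $0\le i_j\le n-j$ and $L_n^q=\mathbb Z[q_1,\ldots,q_{n-1}]\otimes L_n$. The products $e_{p_1}^1\cdots e_{p_{n-1}}^{n-1}$, $0\le p_i\le i$, form a $\mathbb Z$-basis of $L_n$, and $\mathfrak G_w\in L_n$ for $w\in S_n$. Let $\widehat Q:L_n^q\to L_n^q$ be the $\mathbb Z[q_1,\ldots,q_{n-1}]$-linear map with $\widehat Q(e_{p_1}^1\cdots e_{p_{n-1}}^{n-1})=\widehat E_{p_1}^1\cdots\widehat E_{p_{n-1}}^{n-1}$. For $w\in S_n$, $\mathfrak G_w^q:=\widehat Q(\mathfrak G_w)$. Quantum double Grothendieck polynomial of $w_\circ\in S_n$: $$\mathfrak G^q_{w_\circ}(x,y):=\prod_{i=1}^{n-1}\Big(1+\sum_{j=1}^i(-1)^j(1-x_{n-i})^jF_j^i(y)\Big),$$ where $F_j^i(y)$ is $F_j^i$ with $x$ replaced by $y$. *)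

(* Defs.v *)
From HB Require Import structures.
From mathcomp Require Import all_boot all_order all_algebra all_fingroup zify ring.
From mathcomp.multinomials Require Import mpoly.
From Stdlib Require Import ClassicalEpsilon.

Set Implicit Arguments.
Unset Strict Implicit.
Unset Printing Implicit Defensive.

Import GRing.Theory.
Local Open Scope ring_scope.

(* Indices are shifted by one: x_(j+1) is 'X_j with j : 'I_n, and both
   q_(i+1) and s_(i+1) are indexed by i : 'I_n.-1. The ordinals [lo i] and
   [hi i] are i and i+1 as elements of 'I_n. *)

Definition lo n (i : 'I_n.-1) : 'I_n := widen_ord (leq_pred n) i.

Fact hi_subproof n (i : 'I_n.-1) : (i.+1 < n)%N.
Proof. by case: n i => [|n] [i]. Qed.

Definition hi n (i : 'I_n.-1) : 'I_n := Ordinal (hi_subproof i).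

(* [(u * v)%g] applies u first, hence the swap. *)
Definition pcomp n (u v : 'S_n) : 'S_n := (v * u)%g.

Notation "u \oP v" := (pcomp u v) (at level 40, left associativity).

Lemma pcompE n (u v : 'S_n) i : (u \oP v) i = u (v i).
Proof. exact: permM. Qed.

Definition sgen n (i : 'I_n.-1) : 'S_n := tperm (lo i) (hi i).

Definition w0 n : 'S_n := perm (@rev_ord_inj n).

Definition ell n (u : 'S_n) : nat :=
  #|[set p : 'I_n * 'I_n | (p.1 < p.2)%N && (u p.2 < u p.1)%N]|.

Definition word_perm n (a : seq 'I_n.-1) : 'S_n :=
  foldr (fun i u => sgen i \oP u) 1%g a.

Definition reduced_word n (u : 'S_n) (a : seq 'I_n.-1) : bool :=
  (word_perm a == u) && (size a == ell u).

Definition bruhat_step n (u v : 'S_n) : bool :=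
  [exists i, exists j, v == u \oP tperm i j] && (ell u < ell v)%N.

Definition bruhat n (u v : 'S_n) : bool := connect (@bruhat_step n) u v.

Lemma lo_neq_hi n (i : 'I_n.-1) : lo i != hi i.
Proof. by rewrite -val_eqE /= neq_ltn ltnSn. Qed.

Lemma ltn_sgen n (i : 'I_n.-1) (x y : 'I_n) :
  (sgen i y < sgen i x)%N =
  if (x == lo i) && (y == hi i) then true
  else if (x == hi i) && (y == lo i) then false else (y < x)%N.
Proof.
rewrite /sgen !permE /= -!val_eqE /=.
by do ![case: eqVneq => //= ?]; lia.
Qed.

Lemma ell_sgenS n (i : 'I_n.-1) (u : 'S_n) :
  ((u^-1)%g (lo i) < (u^-1)%g (hi i))%N -> ell (sgen i \oP u) = (ell u).+1.
Proof.
set a := (u^-1)%g (lo i); set b := (u^-1)%g (hi i) => ab.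
have ua x : (u x == lo i) = (x == a) by rewrite /a (canF_eq (permK u)).
have ub x : (u x == hi i) = (x == b) by rewrite /b (canF_eq (permK u)).
have ua' : u a = lo i by apply/eqP; rewrite ua.
have ub' : u b = hi i by apply/eqP; rewrite ub.
rewrite /ell; set A := [set p : _ | _ && (u _ < _)%N].
have nA : (a, b) \notin A by rewrite inE /= ua' ub' /= andbC ltnNge leqnSn.
have -> : [set p : 'I_n * 'I_n | (p.1 < p.2)%N &&
    ((sgen i \oP u) p.2 < (sgen i \oP u) p.1)%N] = (a, b) |: A.
  apply/setP => -[x y]; rewrite !inE /= !pcompE ltn_sgen !ua !ub xpair_eqE.
  case: (eqVneq x a) => [->|xa]; case: (eqVneq y b) => [->|yb] //=.
  - by rewrite ab.
  - by case: (eqVneq y a) => [->|]; rewrite ?ltnn ?andbF.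
  - by case: (eqVneq x b) => [->|]; rewrite /= ?ltnn.
  - case: (eqVneq x b) => [->|] //=; case: (eqVneq y a) => [->|] //=.
    by rewrite ltnNge (ltnW ab).
by rewrite cardsU1 nA.
Qed.

Lemma sgenK n (i : 'I_n.-1) (u : 'S_n) : sgen i \oP (sgen i \oP u) = u.
Proof. by rewrite /pcomp -mulgA tperm2 mulg1. Qed.

Lemma ell_sgenP n (i : 'I_n.-1) (u : 'S_n) :
  ((u^-1)%g (hi i) < (u^-1)%g (lo i))%N -> (ell (sgen i \oP u)).+1 = ell u.
Proof.
move=> h; rewrite -(ell_sgenS (i := i)) ?sgenK //.
by rewrite /pcomp invMg !permM tpermV tpermL tpermR.
Qed.

Lemma ell1 n : ell (1%g : 'S_n) = 0%N.
Proof.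
apply/eqP; rewrite cards_eq0; apply/eqP/setP => -[x y].
by rewrite !inE /= !perm1; apply/negbTE; lia.
Qed.

Lemma perm_incr1 n (u : 'S_n) :
  (forall i : 'I_n.-1, (u (lo i) < u (hi i))%N) -> u = 1%g.
Proof.
move=> h.
have hk k : forall x y : 'I_n, y = (x + k)%N :> nat -> (u x + k <= u y)%N.
  elim: k => [|k IH] x y e.
    by rewrite addn0; rewrite (_ : y = x) //; apply: val_inj; rewrite /= e addn0.
  have kn : (x + k < n.-1)%N by have := ltn_ord y; lia.
  have := IH x (lo (Ordinal kn)) erefl; have := h (Ordinal kn).
  have -> : hi (Ordinal kn) = y by apply: val_inj; rewrite /= e addnS.
  by lia.
apply/permP => x; rewrite perm1; apply: val_inj => /=; have xn := ltn_ord x.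
have n0 : (0 < n)%N by apply: leq_ltn_trans xn.
have nn : (n.-1 < n)%N by rewrite prednK.
have := hk x (Ordinal n0) x erefl.
have := hk (n.-1 - x)%N x (Ordinal nn).
have := ltn_ord (u (Ordinal nn)); rewrite /=; lia.
Qed.

Lemma reduced_word_ex n (u : 'S_n) : exists a, reduced_word u a.
Proof.
have [m] := ubnP (ell u); elim: m u => // m IH u; rewrite ltnS => le_m.
case: (pickP [pred i : 'I_n.-1 | ((u^-1)%g (hi i) < (u^-1)%g (lo i))%N]) => /=.
  move=> i hi_lo; have e := ell_sgenP hi_lo.
  have [|a /andP[/eqP aP /eqP sz]] := IH (sgen i \oP u); first by rewrite e.
  by exists (i :: a); rewrite /reduced_word /= -/(word_perm a) aP sgenK sz e !eqxx.
move=> h; exists [::]; rewrite /reduced_word /=.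
suff -> : u = 1%g by rewrite ell1 !eqxx.
apply: invg_inj; rewrite invg1; apply: perm_incr1 => i.
have := h i; rewrite /= => /negbT; rewrite -leqNgt leq_eqVlt => /orP[|//].
by rewrite val_eqE (inj_eq perm_inj) (negbTE (lo_neq_hi i)).
Qed.

(* Hence [ell] is the Coxeter length. *)
Lemma ell_word_perm n (a : seq 'I_n.-1) : (ell (word_perm a) <= size a)%N.
Proof.
elim: a => [|i a IH] /=; first by rewrite ell1.
set u := word_perm a in IH *.
case: (ltngtP ((u^-1)%g (lo i)) ((u^-1)%g (hi i))) => [h|h|/val_inj/perm_inj/eqP].
- by rewrite ell_sgenS.
- by have := ell_sgenP h; lia.
- by rewrite (negbTE (lo_neq_hi i)).
Qed.

Lemma ddiff_ex n (i : 'I_n.-1) (f : {mpoly int[n]}) :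
  exists g, ('X_(lo i) - 'X_(hi i)) * g == f - msym (sgen i) f.
Proof.
set d := 'X_(lo i) - 'X_(hi i); pose s := @msym n int (sgen i).
pose P f := exists g, d * g == f - s f.
have PC c : P c%:MP.
  by exists 0; rewrite mulr0 /s -[c%:MP]mulr1 mul_mpolyC msymZ msym1 subrr.
have PD f1 f2 : P f1 -> P f2 -> P (f1 + f2).
  move=> [g1 /eqP h1] [g2 /eqP h2]; exists (g1 + g2).
  by rewrite mulrDr h1 h2 /s msymD; apply/eqP; ring.
have PM f1 f2 : P f1 -> P f2 -> P (f1 * f2).
  move=> [g1 /eqP h1] [g2 /eqP h2]; exists (g1 * f2 + s f1 * g2).
  rewrite mulrDr mulrA h1 mulrCA h2 /s msymM; apply/eqP; ring.
have PX j : P 'X_j.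
  have sX : s 'X_j = 'X_(sgen i j).
    by rewrite /s /msym mmapX mmap1U.
  rewrite /P sX /sgen; case: tpermP => [->|->|_ _].
  - by exists 1; rewrite mulr1.
  - by exists (-1); rewrite mulrN1 opprB.
  - by exists 0; rewrite mulr0 subrr.
have PXn j k : P ('X_j ^+ k).
  by elim: k => [|k IH]; [rewrite expr0; exact: PC 1 | rewrite exprS; apply: PM].
elim/mpolyind: f => [|c m p _ _ IH]; first by rewrite -mpolyC0; exact: PC 0.
apply: PD => //; rewrite -mul_mpolyC; apply: (PM) => //.
rewrite mpolyXE_id; elim/big_rec: _ => [|j q _ Pq]; first exact: PC 1.
exact: PM.
Qed.

Definition ddiff n (i : 'I_n.-1) (f : {mpoly int[n]}) : {mpoly int[n]} :=
  xchoose (ddiff_ex i f).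

Lemma ddiffE n (i : 'I_n.-1) (f : {mpoly int[n]}) :
  ('X_(lo i) - 'X_(hi i)) * ddiff i f = f - msym (sgen i) f.
Proof. exact/eqP/(xchooseP (ddiff_ex i f)). Qed.

Definition pi_gen n (i : 'I_n.-1) (f : {mpoly int[n]}) : {mpoly int[n]} :=
  f + (1 - 'X_(lo i)) * ddiff i f.

Definition reduced_dec n (u : 'S_n) : seq 'I_n.-1 := xchoose (reduced_word_ex u).

Definition pi_perm n (u : 'S_n) (f : {mpoly int[n]}) : {mpoly int[n]} :=
  foldr (@pi_gen n) f (reduced_dec u).

Definition groth_w0 n : {mpoly int[n]} :=
  \prod_(i < n.-1) 'X_(lo i) ^+ (n - i.+1).

Definition groth n (w : 'S_n) : {mpoly int[n]} :=
  pi_perm (w^-1 \oP w0 n)%g (groth_w0 n).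

Definition dual_groth n (w : 'S_n) : {mpoly int[n]} :=
  \sum_(v : 'S_n | bruhat w v) (-1) ^+ (ell v - ell w) * groth v.

Notation Zq n := {mpoly int[n.-1]}.
Notation Zqx n := {mpoly (Zq n)[n]}.

Definition qvar n (i : 'I_n.-1) : Zqx n := ('X_i : Zq n)%:MP.

(* Subsets of {1, ..., k} of size p, for k <= n - 1. *)
Definition ksubset n (k p : nat) (I : {set 'I_n.-1}) : bool :=
  (I \subset [set i : 'I_n.-1 | (i < k)%N]) && (#|I| == p).

Definition elsym n (k p : nat) : Zqx n :=
  \sum_(I | @ksubset n k p I) \prod_(i in I) 'X_(lo i).

Definition qF n (k p : nat) : Zqx n :=
  \sum_(I | @ksubset n k p I)
    (\prod_(i in I) (1 - 'X_(lo i))) *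
    (\prod_(i in I | [forall j in I, val j != i.+1]) (1 - qvar i)).

Lemma qF0 n k : qF n k 0 = 1.
Proof.
rewrite /qF (big_pred1 set0) => [|I]; first by rewrite !big_pred0 ?mulr1 // => i; rewrite inE.
rewrite /ksubset cards_eq0; apply/andP/eqP => [[_ /eqP]//|->].
by rewrite sub0set eqxx.
Qed.

Definition qE n (k p : nat) : Zqx n :=
  \sum_(i < p.+1) (-1) ^+ i * 'C(k - i, p - i)%:R * qF n k i.

(* L_n^q; the bound on the exponent of 'X_j forces the last variable out. *)
Definition in_Lq n (f : Zqx n) : Prop :=
  forall m : 'X_{1..n}, m \in msupp f -> forall j : 'I_n, (m j <= n - j.+1)%N.

Definition is_quantization n (Q : Zqx n -> Zqx n) : Prop :=
  (forall (c : Zq n) (f g : Zqx n),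
     in_Lq f -> in_Lq g -> Q (c *: f + g) = c *: Q f + Q g) /\
  (forall p : 'I_n.-1 -> nat, (forall i, p i <= i.+1)%N ->
     Q (\prod_(i < n.-1) elsym n i.+1 (p i)) = \prod_(i < n.-1) qE n i.+1 (p i)).

(* The two conditions determine the values on L_n^q, since the products of the
   [elsym n i.+1 (p i)] form a basis; values outside L_n^q are arbitrary. *)
Definition Qhat n : Zqx n -> Zqx n := epsilon (inhabits id) (@is_quantization n).

Definition qgroth n (w : 'S_n) : Zqx n :=
  Qhat (map_mpoly (intr : int -> Zq n) (groth w)).

(* Polynomials in x over Z[q][y]; the variables of [Zqx n] play the role of y. *)
Notation Zqyx n := {mpoly (Zqx n)[n]}.

Definition qdgroth_w0 n : Zqyx n :=
  \prod_(i < n.-1)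
    (1 + \sum_(1 <= j < i.+2)
       (-1) ^+ j * (1 - 'X_(lo (rev_ord i))) ^+ j * (qF n i.+1 j)%:MP).

(* Main.v *)
From HB Require Import structures.
Require Import Defs.
From mathcomp Require Import all_boot all_order all_algebra all_fingroup.
From mathcomp Require Import zify ring.
From mathcomp.multinomials Require Import mpoly.
From Stdlib Require Import ClassicalEpsilon.

(* Put X = 1 - x, Y = 1 - y.  At q = 0 the product defining G^q_(w0)(x, y) is
   the kernel K = prod_(a + b <= n) (1 - X_a Y_b).  Expanded in the e_j (Y_1, ..., Y_i),
   it is carried by Q-hat in y to G^q_(w0)(x, y), because the binomial substitution
   relating the e_j (1 - y) to the e_l (y) is the involution relating F to E-hat.  So it suffices to prove the classical identity
   K = sum_w H_w(x) G_(w w0)(y) and to apply Q-hat in y, coefficientwise in x.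

   Both sides D satisfy pi_i^x D = pi_(n-i)^y D: for K because
   K = (1 - X_i Y_(n-i)) P with P symmetric in x_i, x_(i+1) and in y_(n-i), y_(n-i+1), for the sum
   because (pi_i - 1) H_w is H_(w s_i) or -H_w, which follows from the lifting property of the
   Bruhat order.  Both agree at x = 0, and both lie in L_n as polynomials in x.
   Applying all linear functionals in y to their difference gives a subgroup of
   L_n stable under the pi_i and consisting of polynomials without constant
   term; the lowest component of a member is symmetric, hence zero.

   Q-hat exists because the e-products span L_n, so that the square matrix
   expressing them through the monomials is invertible. *)

Set Implicit Arguments.
Unset Strict Implicit.
Unset Printing Implicit Defensive.

Import GRing.Theory.
Local Open Scope ring_scope.

(** * Isobaric divided differences *)

Section AbstractIsobaric.
Variables (R : idomainType) (s : {rmorphism R -> R}) (x y : R) (D : R -> R).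
Hypotheses (xy : x - y != 0) (sx : s x = y) (sy : s y = x) (sK : involutive s).
Hypothesis DE : forall f, (x - y) * D f = (1 - y) * f - (1 - x) * s f.

(** [DE] is $\pi_i$ cleared of its denominator. Since [x - y] cancels, it determines [D], and the
    laws of [D] reduce to ring identities. *)
Lemma isobaric_eq f g : (x - y) * g = (1 - y) * f - (1 - x) * s f -> D f = g.
Proof. by rewrite -DE => /(mulfI xy) ->. Qed.

Lemma isobaricB f g : D (f - g) = D f - D g.
Proof. by apply: isobaric_eq; rewrite mulrBr !DE rmorphB; ring. Qed.

Lemma isobaricMr f g : s f = f -> D (f * g) = f * D g.
Proof. by move=> sf; apply: isobaric_eq; rewrite mulrCA DE rmorphM sf; ring. Qed.

Lemma isobaric1 : D 1 = 1.
Proof. by apply: isobaric_eq; rewrite rmorph1; ring. Qed.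

Lemma isobaric_sym f : s f = f -> D f = f.
Proof. by move=> sf; rewrite -[f in LHS]mulr1 isobaricMr // isobaric1 mulr1. Qed.

(** Applying [s] to [DE] changes the sign of [x - y] and of the right-hand side. *)
Lemma isobaric_inv f : s (D f) = D f.
Proof.
apply: (mulfI xy); apply: oppr_inj; rewrite DE -mulNr opprB.
by have := congr1 s (DE f); rewrite !(rmorphM, rmorphB, rmorph1) /= sx sy sK => ->; ring.
Qed.

End AbstractIsobaric.

(** * Commutation and braid relations *)

Section AbstractBraid.
Variables (R : idomainType) (s t : {rmorphism R -> R}) (D E : R -> R).
Hypotheses (sK : involutive s) (tK : involutive t).

Lemma isobaric_comm (x y z w : R) (f : R) :
  x - y != 0 -> z - w != 0 ->
  (forall f, (x - y) * D f = (1 - y) * f - (1 - x) * s f) ->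
  (forall f, (z - w) * E f = (1 - w) * f - (1 - z) * t f) ->
  s z = z -> s w = w -> t x = x -> t y = y -> s (t f) = t (s f) ->
  D (E f) = E (D f).
Proof.
move=> xy zw DE EE sz sw tx ty st; apply: (mulfI (mulf_neq0 xy zw)).
have := congr1 s (EE f); have := congr1 t (DE f).
rewrite !(rmorphM, rmorphB, rmorph1) /= sz sw tx ty st.
move: (DE (E f)) (EE (D f)) (DE f) (EE f) => h1 h2 h3 h4 h5 h6.
transitivity ((z - w) * ((x - y) * D (E f))); first by ring.
rewrite h1; transitivity ((1 - y) * ((z - w) * E f) - (1 - x) * ((z - w) * s (E f))).
  by ring.
rewrite h4 h6; transitivity ((x - y) * ((z - w) * E (D f))); last by ring.
rewrite h2; transitivity ((1 - w) * ((x - y) * D f) - (1 - z) * ((x - y) * t (D f))).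
  by rewrite h3 h5; ring.
by ring.
Qed.

(** The images of [f] under words in [s] and [t] are independent unknowns here, with [w] for
    [s (t (s f))] and [k] for [D (E (D f))], so that [ring] can decide. The same six-term right-hand
    side comes out of [E (D (E f))] in [braid_cancel']. *)
Lemma braid_cancel (a b c f sf tf stf tsf w g tg sg stg h sh k : R) :
  (a - b) * g = (1 - b) * f - (1 - a) * sf ->
  (a - c) * tg = (1 - c) * tf - (1 - a) * tsf ->
  (b - c) * stg = (1 - c) * stf - (1 - b) * w ->
  sg = g ->
  (b - c) * h = (1 - c) * g - (1 - b) * tg ->
  (a - c) * sh = (1 - c) * sg - (1 - a) * stg ->
  (a - b) * k = (1 - b) * h - (1 - a) * sh ->
  (a - b) * (a - c) * (b - c) * k =
    (1 - b) * (1 - c) ^+ 2 * f - (1 - a) * (1 - c) ^+ 2 * sf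
    - (1 - b) ^+ 2 * (1 - c) * tf
    + (1 - a) * (1 - b) ^+ 2 * tsf
    + (1 - a) ^+ 2 * (1 - c) * stf
    - (1 - a) ^+ 2 * (1 - b) * w.
Proof.
move=> e1 e2 e3 -> e5 e6 e7; apply/eqP; rewrite -subr_eq0; apply/eqP.
(* Substituting [e5] and [e6] into [e7] leaves [g] with coefficient [1 - c] times [(1 - b) * (a - c)
   - (1 - a) * (b - c) = (1 - c) * (a - b)], whence the factor [(1 - c) ^+ 2] of [e1]. *)
transitivity (
  (a - c) * (b - c) * ((a - b) * k - ((1 - b) * h - (1 - a) * sh))
  + (1 - b) * (a - c) * ((b - c) * h - ((1 - c) * g - (1 - b) * tg))
  - (1 - a) * (b - c) * ((a - c) * sh - ((1 - c) * g - (1 - a) * stg))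
  + (1 - c) ^+ 2 * ((a - b) * g - ((1 - b) * f - (1 - a) * sf))
  - (1 - b) ^+ 2 * ((a - c) * tg - ((1 - c) * tf - (1 - a) * tsf))
  + (1 - a) ^+ 2 * ((b - c) * stg - ((1 - c) * stf - (1 - b) * w))); first by ring.
by rewrite e1 e2 e3 e5 e6 e7 !subrr !mulr0 !(addr0, subr0).
Qed.

Lemma braid_cancel' (a b c f sf tf stf tsf w g tg sg tsg h th k : R) :
  (b - c) * g = (1 - c) * f - (1 - b) * tf ->
  (a - c) * sg = (1 - c) * sf - (1 - a) * stf ->
  (a - b) * tsg = (1 - b) * tsf - (1 - a) * w ->
  tg = g ->
  (a - b) * h = (1 - b) * g - (1 - a) * sg ->
  (a - c) * th = (1 - c) * tg - (1 - a) * tsg ->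
  (b - c) * k = (1 - c) * h - (1 - b) * th ->
  (a - b) * (a - c) * (b - c) * k =
    (1 - b) * (1 - c) ^+ 2 * f - (1 - a) * (1 - c) ^+ 2 * sf
    - (1 - b) ^+ 2 * (1 - c) * tf
    + (1 - a) * (1 - b) ^+ 2 * tsf
    + (1 - a) ^+ 2 * (1 - c) * stf
    - (1 - a) ^+ 2 * (1 - b) * w.
Proof.
move=> e1 e2 e3 -> e5 e6 e7; apply/eqP; rewrite -subr_eq0; apply/eqP.
transitivity (
  (a - b) * (a - c) * ((b - c) * k - ((1 - c) * h - (1 - b) * th))
  + (1 - c) * (a - c) * ((a - b) * h - ((1 - b) * g - (1 - a) * sg))
  - (1 - b) * (a - b) * ((a - c) * th - ((1 - c) * g - (1 - a) * tsg))
  + (1 - b) * (1 - c) * ((b - c) * g - ((1 - c) * f - (1 - b) * tf))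
  - (1 - a) * (1 - c) * ((a - c) * sg - ((1 - c) * sf - (1 - a) * stf))
  + (1 - a) * (1 - b) * ((a - b) * tsg - ((1 - b) * tsf - (1 - a) * w))); first by ring.
by rewrite e1 e2 e3 e5 e6 e7 !subrr !mulr0 !(addr0, subr0).
Qed.


Lemma isobaric_braid (a b c : R) (f : R) :
  a - b != 0 -> b - c != 0 -> a - c != 0 ->
  (forall f, (a - b) * D f = (1 - b) * f - (1 - a) * s f) ->
  (forall f, (b - c) * E f = (1 - c) * f - (1 - b) * t f) ->
  s a = b -> s b = a -> s c = c -> t a = a -> t b = c -> t c = b ->
  (forall f, s (t (s f)) = t (s (t f))) ->
  D (E (D f)) = E (D (E f)).
Proof.
move=> ab bc ac DE EE sa sb sc ta tb tc sts.
apply: (mulfI (mulf_neq0 (mulf_neq0 ab ac) bc)).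
rewrite (@braid_cancel a b c f (s f) (t f) (s (t f)) (t (s f)) (s (t (s f)))
  (D f) (t (D f)) (s (D f)) (s (t (D f))) (E (D f)) (s (E (D f)))) //.
- symmetry; apply: (@braid_cancel' a b c f (s f) (t f) (s (t f)) (t (s f))
    (s (t (s f))) (E f) (t (E f)) (s (E f)) (t (s (E f))) (D (E f)) (t (D (E f)))) => //.
  + by have := congr1 s (EE f); rewrite !(rmorphM, rmorphB, rmorph1) /= sb sc.
  + have := congr1 (t \o s) (EE f).
    by rewrite /= !(rmorphM, rmorphB, rmorph1) /= sb sc ta tc sts.
  + exact: (isobaric_inv bc tb tc tK EE).
  + by have := congr1 t (DE (E f)); rewrite !(rmorphM, rmorphB, rmorph1) /= ta tb.
- by have := congr1 t (DE f); rewrite !(rmorphM, rmorphB, rmorph1) /= ta tb.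
- have := congr1 (s \o t) (DE f).
  by rewrite /= !(rmorphM, rmorphB, rmorph1) /= ta tb sa sc.
- exact: (isobaric_inv ab sa sb sK DE).
- by have := congr1 s (EE (D f)); rewrite !(rmorphM, rmorphB, rmorph1) /= sb sc.
Qed.

End AbstractBraid.

(** Locked so that unification does not unfold the [xchoose] inside [ddiff]. *)
HB.lock Definition demazure n (i : 'I_n.-1) (f : {mpoly int[n]}) := pi_gen i f.

Lemma pi_gen_demazure n (i : 'I_n.-1) : @pi_gen n i =1 demazure i.
Proof. by move=> f; rewrite unlock. Qed.

Section Isobaric.
Variable n : nat.
Implicit Types (i j : 'I_n.-1) (f g : {mpoly int[n]}).

Lemma msymXU (R : nzRingType) (s : 'S_n) (k : 'I_n) :
  msym s ('X_k : {mpoly R[n]}) = 'X_(s k).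
Proof. by rewrite /msym mmapX mmap1U. Qed.

Lemma sub_mpolyX_neq0 (k l : 'I_n) : k != l -> 'X_k - 'X_l != 0 :> {mpoly int[n]}.
Proof.
move=> kl; apply/eqP => /(congr1 (mcoeff U_(k))).
by rewrite mcoeffB !mcoeffXU eqxx eq_sym (negbTE kl) mcoeff0.
Qed.

Lemma sgenL i : sgen i (lo i) = hi i. Proof. exact: tpermL. Qed.
Lemma sgenR i : sgen i (hi i) = lo i. Proof. exact: tpermR. Qed.

Lemma msymXlo (R : nzRingType) i : msym (sgen i) ('X_(lo i) : {mpoly R[n]}) = 'X_(hi i).
Proof. by rewrite msymXU sgenL. Qed.

Lemma msymXhi (R : nzRingType) i : msym (sgen i) ('X_(hi i) : {mpoly R[n]}) = 'X_(lo i).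
Proof. by rewrite msymXU sgenR. Qed.

Lemma msym_sgenK (R : nzRingType) i : involutive (@msym n R (sgen i)).
Proof. by move=> f; rewrite -msymMm tperm2 msym1m. Qed.

Lemma msym_pcomp (R : nzRingType) (s t : 'S_n) (f : {mpoly R[n]}) :
  msym (s \oP t) f = msym s (msym t f).
Proof. exact: msymMm. Qed.

Definition subX_lo_hi_neq0 i := sub_mpolyX_neq0 (lo_neq_hi i).

Lemma demazureE i f :
  ('X_(lo i) - 'X_(hi i)) * demazure i f =
  (1 - 'X_(hi i)) * f - (1 - 'X_(lo i)) * msym (sgen i) f.
Proof.
rewrite -pi_gen_demazure /pi_gen mulrDr mulrCA ddiffE.
by move: 'X_(lo i) 'X_(hi i) (msym _ _) => x y sf; ring.
Qed.

Lemma demazureB i : {morph demazure i : f g / f - g}.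
Proof. exact: (isobaricB (subX_lo_hi_neq0 i) (demazureE i)). Qed.

HB.instance Definition _ i :=
  GRing.isZmodMorphism.Build _ _ (@demazure n i) (demazureB i).

Lemma demazureMr i f g : msym (sgen i) f = f -> demazure i (f * g) = f * demazure i g.
Proof. exact: (isobaricMr (subX_lo_hi_neq0 i) (demazureE i)). Qed.

Lemma demazure_sym i f : msym (sgen i) f = f -> demazure i f = f.
Proof. exact: (isobaric_sym (subX_lo_hi_neq0 i) (demazureE i)). Qed.

Lemma demazure_inv i f : msym (sgen i) (demazure i f) = demazure i f.
Proof.
exact: (isobaric_inv (subX_lo_hi_neq0 i) (msymXlo _ i) (msymXhi _ i) (@msym_sgenK _ i) (demazureE i)).
Qed.

Lemma demazure_idem i f : demazure i (demazure i f) = demazure i f.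
Proof. by rewrite demazure_sym ?demazure_inv. Qed.

Lemma demazure_fixed i f : demazure i f = f -> msym (sgen i) f = f.
Proof. by move=> e; have := demazure_inv i f; rewrite e. Qed.

Lemma sgen_far i j : (i.+1 < j)%N ->
  [/\ sgen i (lo j) = lo j, sgen i (hi j) = hi j,
      sgen j (lo i) = lo i & sgen j (hi i) = hi i].
Proof. by move=> ij; split; apply: tpermD; rewrite -val_eqE /=; lia. Qed.

Lemma sgen_comm i j : (i.+1 < j)%N -> sgen i \oP sgen j = sgen j \oP sgen i.
Proof.
move=> ij; have [ilo ihi jlo jhi] := sgen_far ij; rewrite /pcomp.
by apply/commgP/conjg_fixP; rewrite tpermJ ilo ihi.
Qed.

Lemma sgen_braid i j : j = i.+1 :> nat ->
  sgen i \oP (sgen j \oP sgen i) = sgen j \oP (sgen i \oP sgen j).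
Proof.
move=> ij; have hilo : hi i = lo j by apply: val_inj; rewrite /= ij.
have s_c : sgen i (hi j) = hi j by apply: tpermD; rewrite -val_eqE /=; lia.
have t_a : sgen j (lo i) = lo i by apply: tpermD; rewrite -val_eqE /=; lia.
have st : (sgen i * sgen j * sgen i = tperm (lo i) (hi j))%g.
  by rewrite -mulgA -[X in (X * _)%g]tpermV -conjgE tpermJ s_c -hilo sgenR.
have ts : (sgen j * sgen i * sgen j = tperm (lo i) (hi j))%g.
  by rewrite -mulgA -[X in (X * _)%g]tpermV -conjgE tpermJ t_a hilo sgenL.
exact: etrans st (esym ts).
Qed.

Lemma demazure_comm i j f : (i.+1 < j)%N ->
  demazure i (demazure j f) = demazure j (demazure i f).
Proof.
move=> ij; have [ilo ihi jlo jhi] := sgen_far ij.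
apply: (@isobaric_comm _ (msym (sgen i)) (msym (sgen j)) (demazure i) (demazure j)
  _ _ _ _ f (subX_lo_hi_neq0 i) (subX_lo_hi_neq0 j) (demazureE i) (demazureE j)).
- by rewrite [LHS]msymXU ilo.
- by rewrite [LHS]msymXU ihi.
- by rewrite [LHS]msymXU jlo.
- by rewrite [LHS]msymXU jhi.
exact: etrans (esym (msym_pcomp _ _ f))
  (etrans (congr1 (fun s => msym s f) (sgen_comm ij)) (msym_pcomp _ _ f)).
Qed.

Lemma demazure_braid i j f : j = i.+1 :> nat ->
  demazure i (demazure j (demazure i f)) = demazure j (demazure i (demazure j f)).
Proof.
move=> ij; have hilo : hi i = lo j by apply: val_inj; rewrite /= ij.
have s_c : sgen i (hi j) = hi j by apply: tpermD; rewrite -val_eqE /=; lia.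
have t_a : sgen j (lo i) = lo i by apply: tpermD; rewrite -val_eqE /=; lia.
have ac : 'X_(lo i) - 'X_(hi j) != 0 :> {mpoly int[n]}.
  by apply: sub_mpolyX_neq0; rewrite -val_eqE /=; lia.
have ab := subX_lo_hi_neq0 i; have Ei := @demazureE i; rewrite hilo in ab Ei.
apply: (@isobaric_braid _ (msym (sgen i)) (msym (sgen j)) (demazure i) (demazure j)
  (@msym_sgenK _ i) (@msym_sgenK _ j) _ _ _ f ab (subX_lo_hi_neq0 j) ac Ei (demazureE j)).
- by rewrite [LHS]msymXU sgenL hilo.
- by rewrite [LHS]msymXU -hilo sgenR.
- by rewrite [LHS]msymXU s_c.
- by rewrite [LHS]msymXU t_a.
- by rewrite [LHS]msymXU sgenL.
- by rewrite [LHS]msymXU sgenR.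
move=> g; have p3 s t u : msym (s \oP (t \oP u)) g = msym s (msym t (msym u g)).
  by rewrite (msym_pcomp s) (msym_pcomp t).
exact: etrans (esym (p3 _ _ _)) (etrans (congr1 (fun s => msym s g) (sgen_braid ij)) (p3 _ _ _)).
Qed.

End Isobaric.

(** * Reduced words *)

Section Words.
Variable n : nat.
Implicit Types (i j : 'I_n.-1) (u v w : 'S_n) (a b : seq 'I_n.-1).

Definition ldescent i u := ((u^-1)%g (hi i) < (u^-1)%g (lo i))%N.

Lemma pcompA u v w : u \oP (v \oP w) = u \oP v \oP w.
Proof. exact: esym (mulgA w v u). Qed.

Lemma pcompV u v : ((u \oP v)^-1)%g = (v^-1)%g \oP (u^-1)%g.
Proof. exact: invMg. Qed.

Lemma sgenV i : ((sgen i)^-1)%g = sgen i.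
Proof. exact: tpermV. Qed.

Lemma ldescent_sgenM i j u : ldescent j (sgen i \oP u) =
  ((u^-1)%g (sgen i (hi j)) < (u^-1)%g (sgen i (lo j)))%N.
Proof. by rewrite /ldescent pcompV sgenV !pcompE. Qed.

Lemma ldescentP i u :
  if ldescent i u then (ell (sgen i \oP u)).+1 = ell u
  else ell (sgen i \oP u) = (ell u).+1.
Proof.
case: ifP => [/ell_sgenP //|/negbT]; rewrite -leqNgt leq_eqVlt => /orP[|/ell_sgenS //].
by rewrite val_eqE (inj_eq perm_inj) (negbTE (lo_neq_hi i)).
Qed.

Lemma reduced_word_cons i a u :
  reduced_word u (i :: a) = ldescent i u && reduced_word (sgen i \oP u) a.
Proof.
rewrite /reduced_word /= -/(word_perm a).
have -> : (sgen i \oP word_perm a == u) = (word_perm a == sgen i \oP u).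
  by apply/eqP/eqP => [<-|->]; rewrite sgenK.
case: eqP => [e|]; rewrite ?andbF //=.
have := ldescentP i u; case: ifP => _ h; first by rewrite -h eqSS.
by have := ell_word_perm a; rewrite e h; lia.
Qed.

Definition demazure_word a (f : {mpoly int[n]}) := foldr (@demazure n) f a.

(** Matsumoto's argument, by induction on length. Words starting with [k] and [l] are compared
    through two reduced words of [u] with a common tail [x]: [k l x] and [l k x] if the letters are
    far apart, [k l k x] and [l k l x] if adjacent. The tails agree by induction, the heads by
    commutation or braiding. *)
Lemma demazure_word_eq u a b f : reduced_word u a -> reduced_word u b ->
  demazure_word a f = demazure_word b f.
Proof.
have [m] := ubnP (ell u); elim: m u a b => // m IH u a b; rewrite ltnS => le_m.
case: a => [|i a].
  by case: b => // j b /andP[_ /eqP e1] /andP[_ /eqP e2]; rewrite -e2 in e1.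
case: b => [/andP[_ /eqP e1] /andP[_ /eqP e2]|j b]; first by rewrite -e2 in e1.
have sub k : ldescent k u -> (ell (sgen k \oP u) < m)%N.
  by move=> h; have := ldescentP k u; rewrite h; lia.
have key (k l : 'I_n.-1) c d : (k < l)%N -> reduced_word u (k :: c) -> reduced_word u (l :: d) ->
    demazure_word (k :: c) f = demazure_word (l :: d) f.
  rewrite !reduced_word_cons => kl /andP[dk rk] /andP[dl rl].
  have [lk|lk] := ltnP k.+1 l.
    have [klo khi llo lhi] := sgen_far lk.
    have [x rx] := reduced_word_ex (sgen k \oP (sgen l \oP u)).
    have h1 : reduced_word (sgen k \oP u) (l :: x).
      by rewrite reduced_word_cons ldescent_sgenM klo khi -/(ldescent l u) dl pcompA -sgen_comm // -pcompA.
    have h2 : reduced_word (sgen l \oP u) (k :: x).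
      by rewrite reduced_word_cons ldescent_sgenM llo lhi rx andbT.
    by rewrite /= (IH _ _ _ (sub _ dk) rk h1) (IH _ _ _ (sub _ dl) rl h2) /= demazure_comm.
  have kl1 : l = k.+1 :> nat by lia.
  have hl : hi k = lo l by apply: val_inj; rewrite /= kl1.
  have s_c : sgen k (hi l) = hi l by apply: tpermD; rewrite -val_eqE /=; lia.
  have t_a : sgen l (lo k) = lo k by apply: tpermD; rewrite -val_eqE /=; lia.
  have s_b : sgen k (lo l) = lo k by rewrite -hl sgenR.
  have s_a : sgen k (lo k) = lo l by rewrite -hl sgenL.
  (* The inverse of [u] decreases along the three consecutive values [lo k], [lo l], [hi l], so both
     sides of the braid relation can be split off. *)
  have dkl : ((u^-1)%g (hi l) < (u^-1)%g (lo k))%N.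
    by apply: ltn_trans dl _; rewrite -hl.
  have [x rx] := reduced_word_ex (sgen k \oP (sgen l \oP (sgen k \oP u))).
  have h1 : reduced_word (sgen k \oP u) (l :: k :: x).
    rewrite !reduced_word_cons rx andbT !ldescent_sgenM s_c s_b dkl /=.
    by rewrite pcompV sgenV !pcompE hl sgenL t_a s_a s_c.
  have h2 : reduced_word (sgen l \oP u) (k :: l :: x).
    rewrite !reduced_word_cons !ldescent_sgenM hl sgenL t_a dkl /=.
    rewrite pcompV sgenV !pcompE s_b s_c t_a sgenR -hl -/(ldescent k u) dk /=.
    suff -> : sgen l \oP (sgen k \oP (sgen l \oP u)) = sgen k \oP (sgen l \oP (sgen k \oP u)) by [].
    by have := sgen_braid kl1; rewrite !pcompA => ->.
  by rewrite /= (IH _ _ _ (sub _ dk) rk h1) (IH _ _ _ (sub _ dl) rl h2) /= demazure_braid.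
move=> ra rb; case: (ltngtP i j) => [ij|ij|/val_inj ij]; [exact: key|by apply/esym/key|].
move: ra rb; rewrite !reduced_word_cons -ij => /andP[di ra] /andP[_ rb] /=.
by rewrite (IH _ _ _ (sub _ di) ra rb).
Qed.

Lemma pi_permE u a f : reduced_word u a -> pi_perm u f = demazure_word a f.
Proof.
move=> ra; rewrite -(demazure_word_eq f (xchooseP (reduced_word_ex u)) ra).
rewrite /pi_perm -/(reduced_dec u) /demazure_word.
by elim: (reduced_dec u) => //= i b ->; rewrite pi_gen_demazure.
Qed.

Lemma demazure_pi_perm i u f :
  demazure i (pi_perm u f) = pi_perm (if ldescent i u then u else sgen i \oP u) f.
Proof.
case: ifP => du.
  have [a ra] := reduced_word_ex (sgen i \oP u).
  have r : reduced_word u (i :: a) by rewrite reduced_word_cons du.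
  by rewrite (pi_permE f r) /= demazure_idem.
have [a ra] := reduced_word_ex u.
have r : reduced_word (sgen i \oP u) (i :: a).
  rewrite reduced_word_cons sgenK ra andbT ldescent_sgenM sgenL sgenR.
  have := negbT du; rewrite -leqNgt leq_eqVlt val_eqE (inj_eq perm_inj).
  by rewrite (negbTE (lo_neq_hi i)).
by rewrite (pi_permE f r) (pi_permE f ra).
Qed.

Definition rascent i w := (w (lo i) < w (hi i))%N.

Lemma ell_inv u : ell (u^-1)%g = ell u.
Proof.
suff le v : (ell v <= ell (v^-1)%g)%N.
  by apply/eqP; rewrite eqn_leq le -{2}(invgK u) le.
pose f (p : 'I_n * 'I_n) := (v p.2, v p.1).
have fI : injective f by move=> [x y] [z t] [/perm_inj -> /perm_inj ->].
rewrite /ell -(card_imset _ fI); apply: subset_leq_card.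
by apply/subsetP => _ /imsetP[p pA ->]; move: pA; rewrite !inE /= !permK andbC.
Qed.

Lemma rascentP i w :
  if rascent i w then ell (w \oP sgen i) = (ell w).+1
  else (ell (w \oP sgen i)).+1 = ell w.
Proof.
have := ldescentP i (w^-1)%g; rewrite /ldescent invgK ell_inv -(sgenV i) -pcompV ell_inv sgenV.
rewrite /rascent; case: (ltngtP (w (lo i)) (w (hi i))) => // /val_inj/perm_inj/eqP.
by rewrite (negbTE (lo_neq_hi i)).
Qed.

(** As [w0] reverses the order, the left descents of [w^-1 \oP w0 n] are the right ascents of
    [w]. *)
Lemma demazure_groth i w :
  demazure i (groth w) = groth (if rascent i w then w else w \oP sgen i).
Proof.
rewrite /groth demazure_pi_perm; congr pi_perm.
have -> : ldescent i (w^-1 \oP w0 n)%g = rascent i w.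
  rewrite /ldescent pcompV invgK !pcompE.
  have w0V : ((w0 n)^-1 = w0 n)%g.
    by apply/permP => x; apply: (canLR (permK _)); rewrite !permE rev_ordK.
  rewrite w0V !permE /= /rascent; have := ltn_ord (w (hi i)); lia.
by case: ifP => // _; rewrite pcompV sgenV pcompA.
Qed.

End Words.

(** * Bruhat order and dual Grothendieck polynomials *)

Section Bruhat.
Variable n : nat.
Implicit Types (k : 'I_n.-1) (a b i j : 'I_n) (u v w : 'S_n).

(** The inversions of [u] inject into those of [u \oP t]: both positions are moved by [t] if this
    keeps their order, and the pair is left alone otherwise. The inversion [(a, b)] is not in the
    image. *)
Lemma ell_tperm_gt u a b : (a < b)%N -> (u a < u b)%N -> (ell u < ell (u \oP tperm a b))%N.
Proof.
move=> ab uab; set t := tperm a b.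
pose f (p : 'I_n * 'I_n) := if (t p.1 < t p.2)%N then (t p.1, t p.2) else p.
have tK : involutive t by apply: tpermK.
rewrite /ell; set A := [set p | _]; set B := [set p | _].
have fI : {in A &, injective f}.
  move=> [x y] [z w]; rewrite !inE /= => /andP[xy _] /andP[zw _]; rewrite /f /=.
  case: ifP => h1; case: ifP => h2 // [].
  - by move=> /perm_inj -> /perm_inj ->.
  - by move=> e1 e2; move: h2; rewrite -e1 -e2 !tK xy.
  - by move=> e1 e2; move: h1; rewrite e1 e2 !tK zw.
rewrite -(card_in_imset fI); apply: proper_card; apply/properP; split; last first.
  exists (a, b); first by rewrite inE /= !pcompE /t tpermL tpermR ab.
  apply/imsetP => -[[x y]]; rewrite inE /= /f => /andP[xy yx] /=.
  case: ifP => _ [e1 e2]; last by move: yx uab; rewrite -e1 -e2; lia.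
  by move: xy; rewrite -[x]tK -[y]tK -e1 -e2 /t tpermL tpermR; lia.
apply/subsetP => _ /imsetP[[x y] + ->]; rewrite !inE /f /= => /andP[xy yx].
case: ifP => txy /=; first by rewrite txy !pcompE !tK.
rewrite xy !pcompE /=; move: txy yx xy; rewrite /t => /negbT; rewrite -leqNgt.
by case: tpermP => [->|->|_ _]; case: tpermP => [->|->|_ _] //; lia.
Qed.

Lemma pcomp1 u : u \oP 1%g = u.
Proof. by apply/permP => x; rewrite pcompE perm1. Qed.

Lemma pcomp_tpermK u i j : u \oP tperm i j \oP tperm i j = u.
Proof. by apply/permP => x; rewrite !pcompE tpermK. Qed.

Lemma bruhat_stepP u v :
  reflect (exists i j, [/\ (i < j)%N, (u i < u j)%N & v = u \oP tperm i j])
          (bruhat_step u v).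
Proof.
apply: (iffP andP) => [[/existsP[i /existsP[j /eqP e]] uv]|[i [j [ij uij ->]]]].
  wlog ij : i j e / (i < j)%N.
    move=> H; case: (ltngtP i j) => [ij|ij|/val_inj ij]; first exact: (H i j).
      by apply: (H j i) => //; rewrite tpermC.
    by move: uv; rewrite e ij tperm1 pcomp1 ltnn.
  exists i, j; split=> //; case: (ltngtP (u i) (u j)) => // [h|/val_inj/perm_inj h].
    have := @ell_tperm_gt v i j ij; rewrite e !pcompE tpermL tpermR => /(_ h).
    by rewrite pcomp_tpermK ltnNge -e (ltnW uv).
  by move: ij; rewrite h ltnn.
split; last exact: ell_tperm_gt.
by apply/existsP; exists i; apply/existsP; exists j.
Qed.

(** Conjugating [tperm i j] by [sgen k] keeps the two positions in order unless they are [lo k] and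
    [hi k], which is the first alternative. *)
Lemma bruhat_step_sgen k u v : bruhat_step u v ->
  v = u \oP sgen k \/ bruhat_step (u \oP sgen k) (v \oP sgen k).
Proof.
move=> /bruhat_stepP[i [j [ij uij ->]]].
have [e|ne] := boolP ((i == lo k) && (j == hi k)).
  by left; case/andP: e => /eqP -> /eqP ->.
right; apply/bruhat_stepP; exists (sgen k i), (sgen k j); split.
- rewrite ltn_sgen; case: ifP => // _; rewrite ifN //.
  by rewrite andbC.
- by rewrite !pcompE !tpermK.
apply/permP => x; rewrite !pcompE -[x in RHS](tpermK (lo k) (hi k)) -/(sgen k).
by rewrite -inj_tperm ?tpermK //; apply: perm_inj.
Qed.

Lemma bruhat_ell u v : bruhat u v -> (ell u <= ell v)%N.
Proof.
case/connectP => p; elim: p u => [|x p IH] u /= => [_ ->//|/andP[/andP[_ ux] /IH h /h]].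
exact/leq_trans/ltnW.
Qed.

Lemma sgenKr k u : u \oP sgen k \oP sgen k = u.
Proof. exact: pcomp_tpermK. Qed.

Lemma rascent_sgen k u : rascent k (u \oP sgen k) = ~~ rascent k u.
Proof.
rewrite /rascent !pcompE sgenL sgenR; case: ltngtP => // /val_inj/perm_inj/eqP.
by rewrite eq_sym (negbTE (lo_neq_hi k)).
Qed.

Lemma bruhat_step_rascent k u : rascent k u -> bruhat_step u (u \oP sgen k).
Proof. by move=> h; apply/bruhat_stepP; exists (lo k), (hi k); rewrite /= ltnSn. Qed.

(** Half of the lifting property. Steps of the chain are conjugated by [sgen k] until one of them is
    itself multiplication by [sgen k], when the rest of the chain serves, or until [v] is reached,
    when its descent supplies the last step. *)
Lemma bruhat_sgen_descent k u v : bruhat u v -> ~~ rascent k v -> bruhat (u \oP sgen k) v.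
Proof.
case/connectP => p + -> {v}; elim: p u => [|x p IH] u /=.
  move=> _ h; apply: connect1; have := @bruhat_step_rascent k (u \oP sgen k).
  by rewrite rascent_sgen sgenKr; apply.
move=> /andP[ux xp] h; have := IH x xp h; case: (bruhat_step_sgen k ux) => [<-|/connect1 st].
  by move=> _; apply/connectP; exists p.
exact: connect_trans.
Qed.

(** The same argument from the upper end of the chain. *)
Lemma bruhat_sgen_ascent k u v : rascent k u -> bruhat u v -> bruhat u (v \oP sgen k).
Proof.
move=> h; case/connectP => p + -> {v}; elim/last_ind: p => [|p x IH] /=.
  by move=> _; apply/connect1/bruhat_step_rascent.
rewrite rcons_path last_rcons => /andP[/[dup] pth /IH le st].
have upx : bruhat u (last u p) by apply/connectP; exists p.
case: (bruhat_step_sgen k st) => [->|st']; first by rewrite sgenKr.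
exact/(connect_trans le)/connect1.
Qed.

Lemma bruhat_descent k u v : ~~ rascent k v -> bruhat (u \oP sgen k) v = bruhat u v.
Proof.
move=> h; apply/idP/idP => [/bruhat_sgen_descent/(_ h)|]; first by rewrite sgenKr.
by move/bruhat_sgen_descent; apply.
Qed.

Lemma bruhat_lift k u v : rascent k u -> ~~ rascent k v ->
  bruhat u (v \oP sgen k) = bruhat u v.
Proof.
move=> hu hv; apply/idP/idP => [le|]; last exact: bruhat_sgen_ascent.
apply: (connect_trans le); apply: connect1; rewrite -{2}(sgenKr k v).
by apply: bruhat_step_rascent; rewrite rascent_sgen.
Qed.

End Bruhat.

(** * Isobaric operators on dual Grothendieck polynomials *)

Section DualGrothendieck.
Variable n : nat.
Implicit Types (k : 'I_n.-1) (u v w : 'S_n).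

(** The operator $\pi_k-1$ kills the terms with an ascent at [k] and sends [groth v] to
    [groth (v \oP sgen k) - groth v] at a descent. By the lifting property, the pairs [v],
    [v \oP sgen k] so obtained fill exactly the interval above [w \oP sgen k], with the right
    signs. *)
Lemma demazure_dual_groth k w : ~~ rascent k w ->
  demazure k (dual_groth w) = dual_groth w + dual_groth (w \oP sgen k).
Proof.
move=> hw; have hws : rascent k (w \oP sgen k) by rewrite rascent_sgen.
have signM m (f : {mpoly int[n]}) : demazure k ((-1) ^+ m * f) = (-1) ^+ m * demazure k f.
  by rewrite -signr_odd; case: odd; rewrite ?expr1 ?expr0 ?mul1r // !mulN1r raddfN.
apply/eqP; rewrite addrC -subr_eq; apply/eqP.
transitivity (\sum_(v | bruhat w v && ~~ rascent k v)
    (-1) ^+ (ell v - ell w) * (groth (v \oP sgen k) - groth v)).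
  rewrite /dual_groth raddf_sum -sumrB (bigID (rascent k)) /= big1 ?add0r.
    apply: eq_bigr => v /andP[_ hv].
    by rewrite signM -mulrBr demazure_groth (negbTE hv).
  by move=> v /andP[_ hv]; rewrite signM demazure_groth hv subrr.
rewrite /dual_groth [RHS](bigID (rascent k)) /=.
rewrite [X in _ = X + _](reindex_inj (h := fun v => v \oP sgen k)) /=; last exact: mulgI.
have e v : ~~ rascent k v -> bruhat (w \oP sgen k) (v \oP sgen k) = bruhat w v.
  by move=> hv; rewrite bruhat_lift // bruhat_descent.
rewrite [X in _ = X + _](eq_bigl (fun v => bruhat w v && ~~ rascent k v)); last first.
  by move=> v; rewrite rascent_sgen; case hv: (rascent k v); rewrite ?andbF // e ?hv.
rewrite [X in _ = _ + X](eq_bigl (fun v => bruhat w v && ~~ rascent k v)); last first.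
  by move=> v; case hv: (rascent k v); rewrite ?andbF // bruhat_descent ?hv.
rewrite -big_split /=; apply: eq_bigr => v /andP[/bruhat_ell wv hv].
have := rascentP k w; rewrite (negbTE hw) => ew.
have := rascentP k v; rewrite (negbTE hv) => ev.
rewrite -ev -ew subSS (_ : ((ell (v \oP sgen k)).+1 - _ = (ell (v \oP sgen k) - ell (w \oP sgen k)).+1)%N).
  by rewrite exprS mulN1r mulNr mulrBr.
by rewrite subSn //; move: wv; rewrite -ev -ew ltnS.
Qed.

(** By the previous lemma [dual_groth w] is the image of [dual_groth (w \oP sgen k)] under
    $\pi_k-1$, which the idempotent $\pi_k$ kills. *)
Lemma demazure_dual_groth0 k w : rascent k w -> demazure k (dual_groth w) = 0.
Proof.
move=> hw; have := @demazure_dual_groth k (w \oP sgen k).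
rewrite rascent_sgen hw sgenKr => /(_ isT) e.
rewrite -(addKr (dual_groth (w \oP sgen k)) (dual_groth w)) -e.
by rewrite raddfD raddfN /= demazure_idem addNr.
Qed.

End DualGrothendieck.

(** * Degree bounds and the space [L_n] *)

Section Support.
Variables (n : nat) (R : nzRingType).
Implicit Types (f g : {mpoly R[n]}) (b : 'I_n -> nat) (m : 'X_{1..n}) (d : nat).

(** With [b := stair] and coefficients in [Zq n] this is convertible to [in_Lq]. *)
Definition mbound b f := forall m, m \in msupp f -> forall j, (m j <= b j)%N.
Definition morder d f := forall m, m \in msupp f -> (d <= mdeg m)%N.

Lemma mbound_le b b' f : (forall j, b j <= b' j)%N -> mbound b f -> mbound b' f.
Proof. by move=> le h m mf j; apply: leq_trans (h m mf j) (le j). Qed.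

Lemma mboundD b f g : mbound b f -> mbound b g -> mbound b (f + g).
Proof. by move=> hf hg m /msuppD_le; rewrite mem_cat => /orP[/hf|/hg]. Qed.

Lemma mboundN b f : mbound b f -> mbound b (- f).
Proof. by move=> hf m; rewrite (perm_mem (msuppN f)) => /hf. Qed.

Lemma mbound0 b : mbound b 0.
Proof. by move=> m; rewrite msupp0. Qed.

Lemma mbound_sum (I : Type) (r : seq I) (P : pred I) (F : I -> {mpoly R[n]}) b :
  (forall i, P i -> mbound b (F i)) -> mbound b (\sum_(i <- r | P i) F i).
Proof. by move=> h; elim/big_rec: _ => [|i f Pi]; [exact: mbound0|apply/mboundD/h]. Qed.

Lemma mboundM b b' f g : mbound b f -> mbound b' g ->
  mbound (fun j => b j + b' j)%N (f * g).
Proof.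
move=> hf hg m /msuppM_le/allpairsP[[m1 m2] /= [h1 h2 ->]] j.
by rewrite mnmDE leq_add ?hf ?hg.
Qed.

Lemma mboundC b c : mbound b c%:MP.
Proof. by move=> m; rewrite msuppC; case: eqP => // _; rewrite inE => /eqP -> j; rewrite mnm0E. Qed.

Lemma mboundZ b c f : mbound b f -> mbound b (c *: f).
Proof. by move=> hf m /msuppZ_le/hf. Qed.

Lemma mboundX k : mbound (fun j => (k == j) : nat) ('X_k : {mpoly R[n]}).
Proof. by move=> m; rewrite msuppX inE => /eqP -> j; rewrite mnm1E. Qed.

Lemma mbound1X k : mbound (fun j => (k == j) : nat) (1 - 'X_k : {mpoly R[n]}).
Proof. by apply: mboundD; [exact: mboundC|apply: mboundN; exact: mboundX]. Qed.

Lemma mbound_prod (I : Type) (r : seq I) (P : pred I) (F : I -> {mpoly R[n]})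
    (b : I -> 'I_n -> nat) :
  (forall i, P i -> mbound (b i) (F i)) ->
  mbound (fun j => \sum_(i <- r | P i) b i j)%N (\prod_(i <- r | P i) F i).
Proof.
move=> h; elim: r => [|i r IH].
  by rewrite big_nil; apply: mbound_le (@mboundC (fun=> 0%N) 1) => j.
rewrite big_cons; case: ifP => Pi; last first.
  by apply: mbound_le IH => j; rewrite big_cons Pi.
by apply: mbound_le (mboundM (h i Pi) IH) => j; rewrite big_cons Pi.
Qed.

Lemma mboundXn b f k : mbound b f -> mbound (fun j => k * b j)%N (f ^+ k).
Proof.
move=> hf; rewrite -[k]card_ord -prodr_const.
apply: (@mbound_le (fun j => \sum_(i in 'I_k) b j)%N) => [j|].
  by rewrite sum_nat_const.
exact: mbound_prod.
Qed.

Lemma morder_le d d' f : (d' <= d)%N -> morder d f -> morder d' f.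
Proof. by move=> le h m mf; apply: leq_trans le (h m mf). Qed.

Lemma morderD d f g : morder d f -> morder d g -> morder d (f + g).
Proof. by move=> hf hg m /msuppD_le; rewrite mem_cat => /orP[/hf|/hg]. Qed.

Lemma morderN d f : morder d f -> morder d (- f).
Proof. by move=> hf m; rewrite (perm_mem (msuppN f)) => /hf. Qed.

Lemma morderM d d' f g : morder d f -> morder d' g -> morder (d + d') (f * g).
Proof.
move=> hf hg m /msuppM_le/allpairsP[[m1 m2] /= [h1 h2 ->]].
by rewrite mdegD leq_add ?hf ?hg.
Qed.

Lemma morder0 f : morder 0 f. Proof. by []. Qed.

Lemma morderX k : morder 1 ('X_k : {mpoly R[n]}).
Proof. by move=> m; rewrite msuppX inE => /eqP ->; rewrite mdeg1. Qed.

Lemma morder_prod (I : Type) (r : seq I) (P : pred I) (F : I -> {mpoly R[n]}) (d : I -> nat) :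
  (forall i, P i -> morder (d i) (F i)) ->
  morder (\sum_(i <- r | P i) d i)%N (\prod_(i <- r | P i) F i).
Proof. by move=> h; elim/big_rec2: _ => // i d' f Pi; apply/morderM/h. Qed.

Lemma mcoeff_mulXU g (k : 'I_n) m :
  ('X_k * g)@_m = if m k == 0%N then 0 else g@_(m - U_(k))%MM.
Proof.
rewrite -commr_mpolyX; case: ifP => [/eqP mk0|/negbT mk].
  apply: memN_msupp_eq0; rewrite (perm_mem (msuppMX _ _)).
  by apply/mapP => -[m' _ e]; move: mk0; rewrite e mnmDE mnm1E eqxx.
by rewrite -{1}(submK (_ : U_(k) <= m)%MM) 1?addmC ?mcoeffMX // lep1mP.
Qed.

(* Among the monomials of [g] obtained from [m] by moving exponents from [l] to
   [k], the one of largest [x_k]-degree cannot cancel in [(x_k - x_l) g]. *)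
Lemma msupp_mulXB g (k l : 'I_n) m : k != l -> m \in msupp g ->
  exists2 m', m' \in msupp (('X_k - 'X_l) * g) &
    [/\ mdeg m' = (mdeg m).+1, (m k < m' k)%N, (m' l <= m l)%N &
        forall j, j != k -> j != l -> m' j = m j].
Proof.
move=> kl; move e : (m l) => c; elim: c m e => [|c IH] m e mg.
  exists (m + U_(k))%MM; last first.
    split; first by rewrite mdegD mdeg1 addn1.
    - by rewrite mnmDE mnm1E eqxx addn1.
    - by rewrite mnmDE mnm1E (negbTE kl) e.
    by move=> j jk jl; rewrite mnmDE mnm1E eq_sym (negbTE jk) addn0.
  rewrite mcoeff_msupp mulrBl mcoeffB !mcoeff_mulXU !mnmDE !mnm1E eqxx (negbTE kl) e /=.
  by rewrite addn1 /= subr0 addmK -mcoeff_msupp.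
set m2 := (m + U_(k) - U_(l))%MM.
have dm : mdeg m2 = mdeg m.
  have : mdeg (m2 + U_(l)) = mdeg (m + U_(k)).
    by rewrite /m2 submK // lep1mP mnmDE e.
  by rewrite !mdegD !mdeg1; lia.
have m2E j : m2 j = (m j + (k == j) - (l == j))%N by rewrite !(mnmDE, mnmBE, mnm1E).
have [m2g|m2g] := boolP (m2 \in msupp g).
  have [|m' m'g [h1 h2 h3 h4]] := IH m2 _ m2g.
    by rewrite m2E e eqxx (negbTE kl); lia.
  exists m' => //; split; first by rewrite h1 dm.
  - by move: h2; rewrite m2E eqxx [l == k]eq_sym (negbTE kl); lia.
  - by lia.
  by move=> j jk jl; rewrite h4 // m2E ![_ == j]eq_sym (negbTE jk) (negbTE jl); lia.
exists (m + U_(k))%MM; last first.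
  split; first by rewrite mdegD mdeg1 addn1.
  - by rewrite mnmDE mnm1E eqxx addn1.
  - by rewrite mnmDE mnm1E (negbTE kl) e addn0.
  by move=> j jk jl; rewrite mnmDE mnm1E eq_sym (negbTE jk) addn0.
rewrite mcoeff_msupp mulrBl mcoeffB !mcoeff_mulXU !mnmDE !mnm1E eqxx (negbTE kl) e /=.
rewrite addn1 /= addmK -/m2 (memN_msupp_eq0 m2g) subr0 -mcoeff_msupp //.
Qed.

End Support.

Lemma mbound_map (n : nat) (R S : nzRingType) (h : {additive R -> S}) b (f : {mpoly R[n]}) :
  mbound b f -> mbound b (map_mpoly h f).
Proof.
move=> hf m; rewrite mcoeff_msupp mcoeff_map_mpoly => hm; apply: hf.
by rewrite mcoeff_msupp; apply: contraNneq hm => ->; rewrite raddf0.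
Qed.

(** * Stability of $L_n$, orders and constant terms *)

Section Filtrations.
Variable n : nat.
Implicit Types (k : 'I_n.-1) (f g : {mpoly int[n]}) (m : 'X_{1..n}) (w : 'S_n).

Local Notation "m # s" := [multinom m (s i) | i < n]
  (at level 40, left associativity, format "m # s").

(* The exponents allowed in [L_n]. *)
Definition stair (j : 'I_n) := (n - j.+1)%N.

Lemma demazure_ddiff k f : demazure k f = f + (1 - 'X_(lo k)) * ddiff k f.
Proof. by rewrite -pi_gen_demazure. Qed.

Lemma msupp_sub_msym k f m : m \in msupp (f - msym (sgen k) f) ->
  m \in msupp f \/ m#(sgen k) \in msupp f.
Proof.
move/msuppB_le; rewrite mem_cat !mcoeff_msupp mcoeff_sym.
by case/orP; [left|right].
Qed.

(** In [f - msym (sgen k) f] both exchanged variables have exponent at most [stair (lo k)]. By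
    [msupp_mulXB], used in both directions, dividing by their difference lowers each bound by one,
    to [stair (hi k)]. This leaves room for the factor [1 - 'X_(lo k)] of [demazure]. *)
Lemma mbound_ddiff k f : mbound stair f ->
  mbound (fun j => if j == lo k then stair (hi k) else stair j) (ddiff k f).
Proof.
move=> hf m mg j; have lh := lo_neq_hi k; rewrite /stair.
have bnd m' : m' \in msupp (('X_(lo k) - 'X_(hi k)) * ddiff k f) ->
    forall i, (m' i <= stair i)%N \/ (m' i <= stair (sgen k i))%N.
  rewrite ddiffE => /msupp_sub_msym[/hf h i|/hf h i]; [by left|right].
  by have := h (sgen k i); rewrite mnmE tpermK.
have [m1 /bnd b1 [_ lt1 _ eq1]] := msupp_mulXB lh mg.
have hl : hi k != lo k by rewrite eq_sym.
have [m2 + [_ lt2 _ _]] := msupp_mulXB hl mg.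
rewrite -opprB mulNr (perm_mem (msuppN _)) => /bnd b2.
case: ifP => [/eqP ->|/negbT jlo].
  by have := b1 (lo k); rewrite sgenL /stair /=; lia.
case: (eqVneq j (hi k)) => [->|jhi].
  by have := b2 (hi k); rewrite sgenR /stair /=; lia.
have sj : sgen k j = j by apply: tpermD; rewrite eq_sym.
by have := b1 j; rewrite sj eq1 // /stair; lia.
Qed.

Lemma mbound_demazure k f : mbound stair f -> mbound stair (demazure k f).
Proof.
move=> hf; rewrite demazure_ddiff; apply: mboundD => //.
have h := mboundM (@mbound1X _ _ (lo k)) (mbound_ddiff (k := k) hf).
apply: mbound_le h => j.
rewrite /stair eq_sym; case: eqP => [->|] /=; rewrite ?add0n //.
by have := hi_subproof k; lia.
Qed.

Lemma morder_ddiff d k f : morder d.+1 f -> morder d (ddiff k f).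
Proof.
move=> hf m /(msupp_mulXB (lo_neq_hi k))[m' + [dm _ _ _]].
rewrite ddiffE -ltnS -dm => /msupp_sub_msym[/hf //|/hf].
by rewrite mdeg_mperm.
Qed.

Lemma morder_demazure d k f : morder d.+1 f -> morder d (demazure k f).
Proof.
move=> hf; rewrite demazure_ddiff; apply: morderD; first exact: morder_le hf.
rewrite -[d]add0n; apply: morderM; first exact: morder0.
exact: morder_ddiff.
Qed.

(** The last variable cannot occur, since its bound is 0, and symmetry moves a positive exponent one
    variable at a time to the last. Symmetry is asked only in the degree of [m], so that the lemma
    applies to one homogeneous component. *)
Lemma stair_sym_coeff0 f m : mbound stair f -> (0 < mdeg m)%N ->
  (forall k m', mdeg m' = mdeg m -> f@_(m'#(sgen k)) = f@_m') -> f@_m = 0.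
Proof.
move=> hf; have [d] := ubnP (mdeg m) => _ m0 hs.
have key c (j : 'I_n) m' : (n - j.+1 = c)%N -> mdeg m' = mdeg m -> (0 < m' j)%N -> f@_m' = 0.
  elim: c j m' => [|c IH] j m' jc dm mj.
    apply: contraTeq mj; rewrite -mcoeff_msupp -leqNgt => /hf /(_ j).
    by rewrite /stair jc.
  have jn : (j < n.-1)%N by lia.
  rewrite -(hs (Ordinal jn)) //.
  apply: (IH (hi (Ordinal jn))); rewrite ?mdeg_mperm //=; first by lia.
  by rewrite mnmE sgenR (_ : lo _ = j) //; apply: val_inj.
have [j mj] : exists j, (0 < m j)%N.
  apply/existsP; apply: contraTT m0; rewrite negb_exists => /forallP h.
  by rewrite -leqNgt leqn0 mdegE big1 // => i _; have := h i; lia.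
exact: (key _ j m erefl).
Qed.

Lemma stair_sym_const f : mbound stair f -> (forall k, msym (sgen k) f = f) -> f = (f@_0%MM)%:MP.
Proof.
move=> hf hs; apply/mpolyP => m; rewrite mcoeffC.
have [->|m0] := eqVneq m 0%MM; first by rewrite mulr1.
rewrite mulr0 stair_sym_coeff0 // ?lt0n ?mdeg_eq0 // => k m' _.
by rewrite -mcoeff_sym hs.
Qed.

(* If [f] in [I] has no term of degree at most [d], neither has
   [(demazure k - 1) f = (1 - x_k) ddiff k f], nor then [ddiff k f]: so the
   component of [f] of degree [d + 1] is symmetric and, lying in [L_n], zero. *)
Lemma demazure_stable_eq0 (I : {mpoly int[n]} -> Prop) :
  (forall f g, I f -> I g -> I (f - g)) ->
  (forall k f, I f -> I (demazure k f)) ->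
  (forall f, I f -> mbound stair f) ->
  (forall f, I f -> f@_0%MM = 0) ->
  forall f, I f -> f = 0.
Proof.
move=> IB ID Ib I0.
have key d : forall f, I f -> morder d.+1 f.
  elim: d => [|d IH] f If.
    move=> m mf; rewrite lt0n mdeg_eq0; apply: contraTneq mf => ->.
    by rewrite mcoeff_msupp I0 // eqxx.
  move=> m mf; have := IH f If m mf; rewrite leq_eqVlt => /orP[/eqP e|//].
  suff f0 : f@_m = 0 by move: mf; rewrite mcoeff_msupp f0 eqxx.
  apply: stair_sym_coeff0; [exact: Ib|by rewrite -e|move=> k m' dm'].
  have dd : morder d.+1 (ddiff k f).
    have -> : ddiff k f = (demazure k f - f) + 'X_(lo k) * ddiff k f.
      by rewrite demazure_ddiff; move: (ddiff k f) 'X_(lo k) => g x; ring.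
    apply: morderD; first by apply: IH; apply: IB => //; apply: ID.
    rewrite -add1n; apply: morderM; first exact: morderX.
    exact/morder_ddiff/IH.
  have hs : morder d.+2 (f - msym (sgen k) f).
    rewrite -ddiffE -add1n; apply: morderM => //.
    by apply: morderD; [exact: morderX|apply: morderN; exact: morderX].
  have := hs m'; rewrite mcoeff_msupp dm' -e ltnn => h.
  have : (f - msym (sgen k) f)@_m' = 0 by apply/eqP; apply: contraT => /h.
  by rewrite mcoeffB mcoeff_sym => /eqP; rewrite subr_eq0 => /eqP.
move=> f /[dup] If /key h; apply/mpolyP => m; rewrite mcoeff0.
apply/eqP; rewrite -[_ == 0]negbK -mcoeff_msupp; apply/negP => mf.
by have := key (mdeg m) f If m mf; rewrite ltnn.
Qed.

Lemma mbound_groth_w0 : mbound stair (groth_w0 n).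
Proof.
apply: (@mbound_le _ _ (fun j => \sum_(i < n.-1) (n - i.+1) * (lo i == j)))%N => [j|]; last first.
  by apply: mbound_prod => i _; apply/mboundXn/mboundX.
have [jn|jn] := ltnP j n.-1.
  rewrite (bigD1 (Ordinal jn)) //= big1 => [|i ij].
    by rewrite addn0 (_ : lo _ = j) ?eqxx ?muln1 //; apply: val_inj.
  case: eqP => [e|]; last by rewrite muln0.
  by case/eqP: ij; apply: val_inj; rewrite /= -e.
rewrite big1 // => i _; case: eqP => [e|]; last by rewrite muln0.
by move: jn; rewrite -e /= leqNgt ltn_ord.
Qed.

Lemma mbound_groth w : mbound stair (groth w).
Proof.
have [a ra] := reduced_word_ex (w^-1 \oP w0 n)%g.
rewrite /groth (pi_permE _ ra) {ra}; elim: a => [|k a IH] /=; first exact: mbound_groth_w0.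
exact: mbound_demazure.
Qed.

Lemma mbound_dual_groth w : mbound stair (dual_groth w).
Proof.
apply: mbound_sum => v _; rewrite -signr_odd; case: odd.
  by rewrite mulN1r; apply: mboundN; apply: mbound_groth.
by rewrite mul1r; apply: mbound_groth.
Qed.

(** The bound is the degree of [groth_w0], where the induction for [morder_groth] starts. *)
Lemma ell_le w : (ell w <= \sum_(i < n.-1) (n - i.+1))%N.
Proof.
have le : (ell w <= #|[set p : 'I_n * 'I_n | (p.1 < p.2)%N]|)%N.
  by apply: subset_leq_card; apply/subsetP => p; rewrite !inE => /andP[].
apply: leq_trans le _; rewrite cardsE -sum1_card.
rewrite (eq_bigl (fun p : 'I_n * 'I_n => true && (p.1 < p.2)%N)) //.
rewrite -(pair_big_dep xpredT (fun x y : 'I_n => (x < y)%N) (fun _ _ => 1%N)) /=.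
rewrite (eq_bigr (fun x : 'I_n => n - x.+1)%N) => [|x _].
  by case: (n) => [|n'] /=; rewrite ?big_ord0 // big_ord_recr /= subnn addn0.
rewrite sum1_card -[RHS](card_ord (n - x.+1)).
have lt (i : 'I_(n - x.+1)) : (x.+1 + i < n)%N by have := ltn_ord i; lia.
rewrite -(card_imset _ (f := fun i : 'I_(n - x.+1) => Ordinal (lt i))); last first.
  by move=> i j [/addnI/val_inj].
apply: eq_card => y; apply/idP/imsetP => [xy|[i _ ->]]; last first.
  by rewrite unfold_in /=; lia.
rewrite unfold_in in xy; have yx : (y - x.+1 < n - x.+1)%N by have := ltn_ord y; lia.
by exists (Ordinal yx) => //; apply: val_inj; rewrite /= subnKC.
Qed.

Lemma w0_all w : (forall k, ~~ rascent k w) -> w = w0 n.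
Proof.
move=> h; have e : w0 n \oP w = 1%g.
  apply: perm_incr1 => k; rewrite !pcompE !permE /=.
  have := h k; rewrite /rascent -leqNgt leq_eqVlt val_eqE (inj_eq perm_inj) eq_sym.
  by rewrite (negbTE (lo_neq_hi k)) /=; have := ltn_ord (w (lo k)); lia.
apply/permP => x; have /permP/(_ x) := e; rewrite pcompE perm1 permE => ex.
by rewrite -[in RHS]ex permE rev_ordK.
Qed.

Lemma groth_w0E : groth (w0 n) = groth_w0 n.
Proof.
have w0V : ((w0 n)^-1 \oP w0 n = 1)%g by apply/permP => x; rewrite pcompE permK perm1.
by rewrite /groth w0V (@pi_permE _ _ [::]) // /reduced_word /= eqxx ell1.
Qed.

(** Descending induction from [w0]: at an ascent, [groth w] is the image of [groth (w \oP sgen k)]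
    under [demazure k], which lowers the order by at most one. *)
Lemma morder_groth w : morder (ell w) (groth w).
Proof.
have [c] := ubnP (\sum_(i < n.-1) (n - i.+1) - ell w)%N.
elim: c w => // c IH w; rewrite ltnS => le.
case: (pickP (fun k => rascent k w)) => [k hk|h].
  have e := rascentP k w; rewrite hk in e.
  have /= := demazure_groth k (w \oP sgen k).
  rewrite rascent_sgen hk /= sgenKr => <-.
  apply: morder_demazure; rewrite -e; apply: IH.
  by have := ell_le (w \oP sgen k); lia.
rewrite (@w0_all w) => [|k]; last by rewrite h.
rewrite groth_w0E; apply: morder_le (ell_le _) _.
apply: morder_prod => i _; rewrite -[X in morder X](card_ord (n - i.+1)) -sum1_card.
by rewrite -[X in 'X_(lo i) ^+ X](card_ord (n - i.+1)) -prodr_const; apply: morder_prod => *; apply: morderX.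
Qed.

Lemma ell_eq0 w : ell w = 0%N -> w = 1%g.
Proof.
move=> w0; apply: perm_incr1 => k; have := rascentP k w; rewrite w0.
by case: ifP.
Qed.

(** The factor [1 - 'X_(lo k)] vanishes at this point, so [demazure k] preserves the value. It
    identifies the constant in [groth1]. *)
Lemma meval1_groth w : (groth w).@[fun=> 1] = 1.
Proof.
have [a ra] := reduced_word_ex (w^-1 \oP w0 n)%g.
rewrite /groth (pi_permE _ ra) {ra}; elim: a => [|k a IH] /=.
  by rewrite rmorph_prod big1 // => i _; rewrite rmorphXn /= mevalXU expr1n.
by rewrite demazure_ddiff rmorphD rmorphM rmorphB rmorph1 /= mevalXU subrr mul0r addr0.
Qed.

(** Fixed by every $\pi_k$, the polynomial is symmetric; lying in $L_n$, it is constant. *)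
Lemma groth1 : groth (1%g : 'S_n) = 1.
Proof.
have h k : msym (sgen k) (groth 1%g) = groth (1%g : 'S_n).
  by apply: demazure_fixed; rewrite demazure_groth ifT // /rascent !perm1 /=.
have e := stair_sym_const (@mbound_groth 1%g) h.
by have := meval1_groth 1%g; rewrite e mevalC => ->.
Qed.

Lemma groth_coeff0 w : (groth w)@_0%MM = (w == 1%g)%:R.
Proof.
have [->|w1] := eqVneq w 1%g; first by rewrite groth1 mcoeff1 eqxx.
apply/eqP; rewrite -[_ == _]negbK -mcoeff_msupp; apply/negP => /morder_groth.
by rewrite mdeg0 leqn0 => /eqP/ell_eq0/eqP; rewrite (negbTE w1).
Qed.

Lemma dual_groth_coeff0 w : (dual_groth w)@_0%MM = (w == 1%g)%:R.
Proof.
rewrite /dual_groth raddf_sum /=.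
have cE c f : ((-1) ^+ c * f)@_0%MM = (-1) ^+ c * f@_0%MM.
  by rewrite -signr_odd -[in RHS]signr_odd; case: odd; rewrite ?expr0 ?mul1r // expr1 !mulN1r mcoeffN.
have [->|w1] := eqVneq w 1%g.
  rewrite (bigD1 1%g) /=; last exact: connect0.
  rewrite cE subnn mul1r groth_coeff0 eqxx big1 ?addr0 //.
  by move=> v /andP[_ /negbTE v1]; rewrite cE groth_coeff0 v1 mulr0.
apply: big1 => v wv; rewrite cE groth_coeff0; case: eqVneq => [v1|]; last by rewrite mulr0.
move: (bruhat_ell wv); rewrite v1 ell1 leqn0 => /eqP/ell_eq0/eqP.
by rewrite (negbTE w1).
Qed.

End Filtrations.

(** * The Cauchy identity *)

Section Cauchy.
Variable n : nat.
Implicit Types (k : 'I_n.-1) (f g : {mpoly int[n]}) (w : 'S_n) (p : 'I_n * 'I_n).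

(** In one-based indices this reads $a+b\le n$. *)
Definition below_diag p := (p.1 + p.2.+1 < n)%N.

Definition cauchy_factor p : {mpoly {mpoly int[n]}[n]} :=
  1 - (1 - 'X_p.1) * (1 - 'X_p.2 : {mpoly int[n]})%:MP.

(* [1 - (1 - x_i) (1 - y_j) = x_i + y_j - x_i y_j], so this is the classical
   double Grothendieck polynomial of [w0]; the outer variables are [x]. *)
Definition cauchy_kernel := \prod_(p | below_diag p) cauchy_factor p.

(** The cell removed is the only one in row [lo k] without a neighbour in row [hi k], and likewise
    for its column and the next. Hence the symmetry in both sets of variables. *)
Definition cauchy_cofactor k :=
  \prod_(p | below_diag p && (p != (lo k, lo (rev_ord k)))) cauchy_factor p.

Lemma cauchy_kernelE k : cauchy_kernel =
  cauchy_factor (lo k, lo (rev_ord k)) * cauchy_cofactor k.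
Proof.
rewrite /cauchy_kernel (bigD1 (lo k, lo (rev_ord k))) //.
by rewrite /below_diag /=; have := ltn_ord k; lia.
Qed.

Lemma msym_cauchy_cofactor k : msym (sgen k) (cauchy_cofactor k) = cauchy_cofactor k.
Proof.
rewrite /cauchy_cofactor rmorph_prod /=.
have sI : injective (fun p : 'I_n * 'I_n => (sgen k p.1, p.2)).
  by move=> [x y] [x' y'] [/perm_inj -> ->].
rewrite [RHS](reindex_inj sI) /=; apply: eq_big => [[x y]|[x y] _] /=.
  rewrite /below_diag !xpair_eqE -!val_eqE /= /sgen.
  by case: tpermP => [->|->|/eqP + /eqP]; rewrite -?val_eqE /=; have := ltn_ord k; have := ltn_ord y; lia.
by rewrite /cauchy_factor !(rmorphB, rmorphM, rmorph1) /= msymXU /msym mmapC.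
Qed.

Lemma map_msym_cauchy_cofactor k :
  map_mpoly (msym (sgen (rev_ord k))) (cauchy_cofactor k) = cauchy_cofactor k.
Proof.
rewrite /cauchy_cofactor rmorph_prod /=.
have sI : injective (fun p : 'I_n * 'I_n => (p.1, sgen (rev_ord k) p.2)).
  by move=> [x y] [x' y'] [-> /perm_inj ->].
rewrite [RHS](reindex_inj sI) /=; apply: eq_big => [[x y]|[x y] _] /=.
  rewrite /below_diag !xpair_eqE -!val_eqE /= /sgen.
  by case: tpermP => [->|->|/eqP + /eqP]; rewrite -?val_eqE /=; have := ltn_ord k; have := ltn_ord x; lia.
by rewrite /cauchy_factor !(rmorphB, rmorphM, rmorph1) /= map_mpolyX map_mpolyC /= msymXU.
Qed.

(** [h] is only additive, so [map_mpoly h] is not multiplicative; it still commutes with factors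
    having integer coefficients. *)
Lemma map_mpoly1XM (R S : nzRingType) (h : {additive R -> S}) (a : 'I_n) (q : {mpoly R[n]}) :
  map_mpoly h ((1 - 'X_a) * q) = (1 - 'X_a) * map_mpoly h q.
Proof.
apply/mpolyP => m; rewrite mcoeff_map_mpoly !mulrBl !mul1r !mcoeffB raddfB.
rewrite !mcoeff_mulXU !mcoeff_map_mpoly; case: ifP => //; by rewrite raddf0.
Qed.

Lemma msym_map_mpoly (R S : nzRingType) (h : {additive R -> S}) (s : 'S_n) (q : {mpoly R[n]}) :
  msym s (map_mpoly h q) = map_mpoly h (msym s q).
Proof. by apply/mpolyP => m; rewrite mcoeff_sym !mcoeff_map_mpoly mcoeff_sym. Qed.

Lemma demazure1X k : demazure k (1 - 'X_(lo k)) = 0.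
Proof.
apply: (isobaric_eq (@subX_lo_hi_neq0 n k) (demazureE k)).
by rewrite rmorphB rmorph1 /= msymXlo; ring.
Qed.

Lemma cauchy_kernelB k : cauchy_kernel = cauchy_cofactor k -
  (1 - 'X_(lo k)) * ((1 - 'X_(lo (rev_ord k)))%:MP * cauchy_cofactor k).
Proof. by rewrite (cauchy_kernelE k) /cauchy_factor mulrBl mul1r mulrA. Qed.

(** In [cauchy_kernelB], $\pi_k$ fixes the first term and kills the second, which is [1 - 'X_(lo k)]
    times a symmetric polynomial. *)
Lemma demazure_map_cauchy (h : {additive {mpoly int[n]} -> int}) k :
  demazure k (map_mpoly h cauchy_kernel) = map_mpoly h (cauchy_cofactor k).
Proof.
rewrite (cauchy_kernelB k) raddfB /= map_mpoly1XM raddfB /= mulrC demazureMr.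
  rewrite demazure1X mulr0 subr0 demazure_sym //.
  by rewrite msym_map_mpoly msym_cauchy_cofactor.
by rewrite msym_map_mpoly rmorphM /= msym_cauchy_cofactor /msym mmapC.
Qed.

(** The same computation in $y$ ends at the same cofactor, so the two actions on the kernel
    agree. *)
Lemma demazure_cauchy_coeff k m :
  demazure (rev_ord k) cauchy_kernel@_m = (cauchy_cofactor k)@_m.
Proof.
have sym q : map_mpoly (msym (sgen (rev_ord k))) q = q ->
    msym (sgen (rev_ord k)) q@_m = q@_m.
  by move=> {2}<-; rewrite mcoeff_map_mpoly.
rewrite (cauchy_kernelB k) mulrCA mcoeffB mcoeffCM raddfB /= mulrC demazureMr.
  by rewrite demazure1X mulr0 subr0 demazure_sym // sym // map_msym_cauchy_cofactor.
by apply: sym; rewrite map_mpoly1XM map_msym_cauchy_cofactor.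
Qed.

Lemma sum_below_diag (x : 'I_n) : (\sum_(y < n | below_diag (x, y)) 1 = n - x.+1)%N.
Proof.
rewrite -[RHS]card_ord -[RHS]sum1_card (big_ord_widen n (fun=> 1%N)) ?leq_subr //.
by apply: eq_bigl => y; rewrite /below_diag /=; have := ltn_ord y; lia.
Qed.

Lemma mbound_cauchy : mbound (@stair n) cauchy_kernel.
Proof.
apply: (@mbound_le _ _ (fun j => \sum_(p | below_diag p) (p.1 == j))%N) => [j|]; last first.
  apply: mbound_prod => p _; apply: mboundD; first exact: mboundC.
  apply: mboundN; rewrite mulrC mul_mpolyC; apply: mboundZ; exact: mbound1X.
rewrite (eq_bigl (fun p => true && below_diag (p.1, p.2))); last by case.
rewrite -(pair_big_dep xpredT (fun x y : 'I_n => below_diag (x, y)) (fun x _ => (x == j : nat))) /=.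
rewrite (bigD1 j) //= [X in (_ + X)%N]big1 => [|x /negbTE xj].
  by rewrite addn0 eqxx sum_below_diag.
by rewrite big1 // xj.
Qed.

Lemma cauchy_coeff0 : cauchy_kernel@_0%MM = groth_w0 n.
Proof.
rewrite /cauchy_kernel rmorph_prod /=.
rewrite (eq_bigr (fun p => 'X_p.2 : {mpoly int[n]})); last first.
  move=> p _; rewrite /cauchy_factor mcoeffB mcoeff1 eqxx mulrC mcoeffCM mcoeffB.
  by rewrite mcoeff1 eqxx mcoeffX mnm1_eq0 subr0 mulr1 opprB addrCA subrr addr0.
rewrite (reindex_inj (h := fun p => (p.2, p.1))) /=; last by move=> [? ?] [? ?] [-> ->].
rewrite (eq_bigl (fun p => true && below_diag (p.1, p.2))); last first.
  by case=> x y; rewrite /below_diag /=; lia.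
rewrite -(pair_big_dep xpredT (fun x y : 'I_n => below_diag (x, y)) (fun x _ => 'X_x)) /=.
rewrite (eq_bigr (fun x : 'I_n => 'X_x ^+ (n - x.+1))) => [|x _].
  rewrite /groth_w0; case: (n) => [|n'] /=; rewrite ?big_ord0 // big_ord_recr /= subnn mulr1.
  by apply: eq_bigr => i _; congr ('X_ _ ^+ _); apply: val_inj.
by rewrite -sum_below_diag prodr_const sum1_card.
Qed.

(** The functional [h] acts on the $y$ variables and brings the coefficients down to [int], where
    [demazure] is defined. *)
Definition cauchy_defect (h : {additive {mpoly int[n]} -> int}) : {mpoly int[n]} :=
  map_mpoly h cauchy_kernel - \sum_w dual_groth w *~ h (groth (w \oP w0 n)).

(** Right multiplication by [w0] exchanges descents at [k] with ascents at [rev_ord k]. Hence both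
    sums become the sum, over [w] with a descent at [k], of $\mathfrak H_w+\mathfrak H_{ws_k}$ times
    [h (groth (w \oP w0 n))]. *)
Lemma demazure_cauchy_defect h k : demazure k (cauchy_defect h) =
  cauchy_defect (h \o demazure (rev_ord k)).
Proof.
rewrite /cauchy_defect raddfB /= demazure_map_cauchy; congr (_ - _).
  by apply/mpolyP => m; rewrite !mcoeff_map_mpoly /= demazure_cauchy_coeff.
rewrite raddf_sum /=.
have w0lo : w0 n (lo (rev_ord k)) = hi k.
  by apply: val_inj; rewrite permE /=; have := ltn_ord k; lia.
have w0hi : w0 n (hi (rev_ord k)) = lo k.
  by apply: val_inj; rewrite permE /=; have := ltn_ord k; lia.
have asc w : rascent (rev_ord k) (w \oP w0 n) = ~~ rascent k w.
  rewrite /rascent !pcompE w0lo w0hi; case: ltngtP => // /val_inj/perm_inj/eqP.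
  by rewrite eq_sym (negbTE (lo_neq_hi k)).
have w0s w : w \oP w0 n \oP sgen (rev_ord k) = w \oP sgen k \oP w0 n.
  rewrite -!pcompA; congr (_ \oP _); apply/permP => x; rewrite !pcompE.
  by rewrite /sgen inj_tperm ?w0lo ?w0hi 1?tpermC //; apply: perm_inj.
under eq_bigr do rewrite raddfMz.
rewrite (bigID (rascent k)) [RHS](bigID (rascent k)) /=.
rewrite big1 ?add0r => [|w hw]; last by rewrite demazure_dual_groth0 // mul0rz.
rewrite [X in _ = X + _](reindex_inj (h := fun w => w \oP sgen k)) /=; last exact: mulgI.
rewrite [X in _ = X + _](eq_bigl (fun w => ~~ rascent k w)) => [|w]; last exact: rascent_sgen.
rewrite -big_split /=; apply: eq_bigr => w hw.
by rewrite demazure_dual_groth // !demazure_groth !asc rascent_sgen (negbTE hw) /= w0s sgenKr mulrzDl addrC.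
Qed.

Lemma cauchy_defect_eq0 h : cauchy_defect h = 0.
Proof.
(* The subgroup consists of the defects of all [h]: subtraction gives [h1 \- h2], and $\pi_k$
   precomposes [h] with an operator in $y$. In the constant term only [w = 1] survives. *)
apply: (@demazure_stable_eq0 _ (fun f => exists h, f = cauchy_defect h)); last by exists h.
- move=> _ _ [h1 ->] [h2 ->]; exists (h1 \- h2).
  rewrite /cauchy_defect.
  have -> : map_mpoly (h1 \- h2) cauchy_kernel =
      map_mpoly h1 cauchy_kernel - map_mpoly h2 cauchy_kernel.
    by apply/mpolyP => m; rewrite mcoeffB !mcoeff_map_mpoly.
  under [X in _ = _ - X]eq_bigr do rewrite /= mulrzBr.
  by rewrite sumrB !opprB addrACA [RHS]addrACA; congr (_ + _); rewrite addrC.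
- by move=> k _ [h1 ->]; exists (h1 \o demazure (rev_ord k)); apply: demazure_cauchy_defect.
- move=> _ [h1 ->]; apply: mboundD; first by apply: mbound_map; apply: mbound_cauchy.
  apply/mboundN/mbound_sum => w _; rewrite -scaler_int; apply: mboundZ.
  exact: mbound_dual_groth.
move=> _ [h1 ->]; rewrite /cauchy_defect mcoeffB mcoeff_map_mpoly cauchy_coeff0.
rewrite raddf_sum /= (bigD1 1%g) //= big1 => [|w /negbTE w1].
  rewrite raddfMz /= dual_groth_coeff0 eqxx addr0.
  have -> : 1%g \oP w0 n = w0 n by apply/permP => x; rewrite pcompE perm1.
  by rewrite groth_w0E intz subrr.
by rewrite raddfMz /= dual_groth_coeff0 w1 mul0rz.
Qed.

(** The functionals [mcoeff m'] separate polynomials in $y$. The identity is stated for each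
    $x$-coefficient because [Qhat] will be applied to each. *)
Theorem cauchy_identity m :
  cauchy_kernel@_m = \sum_w groth (w \oP w0 n) *~ (dual_groth w)@_m.
Proof.
apply/mpolyP => m'; have /(congr1 (mcoeff m)) := cauchy_defect_eq0 (mcoeff m').
rewrite mcoeff0 /cauchy_defect mcoeffB mcoeff_map_mpoly => /eqP.
rewrite subr_eq0 => /eqP ->; rewrite !raddf_sum /=; apply: eq_bigr => w _.
by rewrite !raddfMz /=; move: (_@_m) (_@_m') => x y; rewrite !mulrzz mulrC.
Qed.

End Cauchy.

(** * Elementary symmetric polynomials *)

Section ElementarySpan.
Variables (A : comNzRingType) (z : nat -> A).
Implicit Types (c k m p a : nat) (f g h : A).

(* Coefficient [p] is the [p]-th elementary symmetric polynomial in
   [z c, ..., z (c + k - 1)]. *)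
Definition esym c k : {poly A} := \prod_(i < k) (1 + (z (c + i)%N)%:P * 'X).

Lemma esymSl c k : esym c k.+1 = (1 + (z c)%:P * 'X) * esym c.+1 k.
Proof.
rewrite /esym big_ord_recl addn0; congr (_ * _).
by apply: eq_bigr => i _; rewrite addSnnS.
Qed.

Lemma esymSr c k : esym c k.+1 = esym c k * (1 + (z (c + k)%N)%:P * 'X).
Proof. by rewrite /esym big_ord_recr. Qed.

Lemma coef_esym0 c k : (esym c k)`_0 = 1.
Proof.
elim: k => [|k IH]; first by rewrite /esym big_ord0 coef1.
by rewrite esymSr mulrDr mulr1 mulrA coefD coefMX addr0.
Qed.

Lemma coef_esymSl c k p :
  (esym c k.+1)`_p.+1 = (esym c.+1 k)`_p.+1 + z c * (esym c.+1 k)`_p.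
Proof. by rewrite esymSl mulrDl mul1r mulrAC coefD coefMX /= coefCM. Qed.

Lemma coef_esymSr c k p :
  (esym c k.+1)`_p.+1 = (esym c k)`_p.+1 + z (c + k)%N * (esym c k)`_p.
Proof. by rewrite esymSr mulrDr mulr1 mulrA coefD coefMX /= coefMC mulrC. Qed.

Lemma coef_esym_gt c k p : (k < p)%N -> (esym c k)`_p = 0.
Proof.
elim: k p => [|k IH] [|p] // kp; first by rewrite /esym big_ord0 coef1.
by rewrite coef_esymSr !IH ?mulr0 ?addr0 //; lia.
Qed.

(** The integer span of the products $e_{p_1}^1\cdots e_{p_m}^m$, $0\le p_i\le i$, in the variables
    from [z c] on. The offset [c] lets an induction remove the first variable. *)
Fixpoint espan c m : A -> Prop :=
  if m is m'.+1 then fun f => exists2 g : nat -> A, (forall p, espan c m' (g p)) &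
    f = \sum_(p < m'.+2) g p * (esym c m)`_p
  else fun f => exists s : int, f = s%:~R.

Lemma espan0 c m : espan c m 0.
Proof.
elim: m => [|m IH] /=; first by exists 0.
by exists (fun=> 0) => //; rewrite big1 // => p _; rewrite mul0r.
Qed.

Lemma espanB c m f g : espan c m f -> espan c m g -> espan c m (f - g).
Proof.
elim: m f g => [|m IH] f g /=.
  by case=> s -> [t ->]; exists (s - t); rewrite intrB.
case=> s sP -> [u uP ->]; exists (fun p => s p - u p) => [p|]; first exact: IH.
by rewrite -sumrB; apply: eq_bigr => p _; rewrite mulrBl.
Qed.

Lemma espanD c m f g : espan c m f -> espan c m g -> espan c m (f + g).
Proof.
move=> hf hg; rewrite -[g]opprK; apply: espanB => //.
by rewrite -sub0r; apply: espanB => //; apply: espan0.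
Qed.

Lemma espan_coef c m f p : espan c m f -> (p <= m.+1)%N ->
  espan c m.+1 (f * (esym c m.+1)`_p).
Proof.
move=> hf pm; exists (fun q => if q == p then f else 0) => [q|].
  by case: eqP => // _; apply: espan0.
rewrite (bigD1 (Ordinal (pm : (p < m.+2)%N))) //= eqxx big1 ?addr0 // => q qp.
by rewrite ifN ?mul0r //; apply: contraNneq qp => e; apply/eqP/val_inj.
Qed.

(* With [e'_p] and [e_p] the elementary symmetric polynomials without and
   with [z c], [e_p.+1 = e'_p.+1 + z c * e'_p] either lowers [p] at the price of
   a power of [z c], or raises [p] and saves one. *)
Lemma espan_mulX c m f a : espan c.+1 m f -> (a <= m.+1)%N ->
  espan c m.+1 (z c ^+ a * f).
Proof.
elim: m c f a => [|m IH] c f a.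
  move=> hf; case: a => [|[|a]] // _.
    by rewrite expr0 mulrC -(coef_esym0 c 1); apply: espan_coef.
  have -> : z c ^+ 1 * f = f * (esym c 1)`_1.
    by rewrite coef_esymSl coef_esym0 coef_esym_gt // add0r mulr1 mulrC expr1.
  exact: espan_coef.
case=> g hg -> am; rewrite mulr_sumr.
elim/big_ind: _ => [||p _]; [exact: espan0|exact: espanD|].
have [p' pm] : {p' : nat | p' = p & (p' <= m.+1)%N} by exists (val p); rewrite // -ltnS ltn_ord.
rewrite -pm; have {hg} := hg p'; move: (g p') {pm p} => {}g hg.
move: p' => p pm.
have low : forall p b, (b + p <= m.+1)%N ->
    espan c m.+2 (z c ^+ b * (g * (esym c.+1 m.+1)`_p)).
  elim=> [|q IHq] b bq.
    by rewrite coef_esym0 -(coef_esym0 c m.+2) mulrA; apply: espan_coef => //; apply: IH => //; lia.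
  have -> : z c ^+ b * (g * (esym c.+1 m.+1)`_q.+1) =
      z c ^+ b * g * (esym c m.+2)`_q.+1 - z c ^+ b.+1 * (g * (esym c.+1 m.+1)`_q).
    by rewrite (coef_esymSl c) exprS; ring.
  apply: espanB; last by apply: IHq; lia.
  by apply: espan_coef; [apply: IH => //; lia|lia].
have high : forall d q b, (q + d = m.+2)%N -> (m.+1 < b + q)%N -> (b <= m.+2)%N ->
    espan c m.+2 (z c ^+ b * (g * (esym c.+1 m.+1)`_q)).
  elim=> [|d IHd] q b qd bq bm.
    by rewrite coef_esym_gt ?mulr0; [exact: espan0|lia].
  case: b bq bm => [|b] bq bm; first by lia.
  have -> : z c ^+ b.+1 * (g * (esym c.+1 m.+1)`_q) =
      z c ^+ b * g * (esym c m.+2)`_q.+1 - z c ^+ b * (g * (esym c.+1 m.+1)`_q.+1).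
    by rewrite (coef_esymSl c) exprS; ring.
  apply: espanB; last by apply: IHd; lia.
  by apply: espan_coef; [apply: IH => //; lia|lia].
have [le|gt] := leqP (a + p) m.+1; first exact: low.
by apply: (high (m.+2 - p)%N) => //; lia.
Qed.

Lemma espan_monomial c m (a : nat -> nat) : (forall i, (i < m)%N -> (a i <= m - i)%N) ->
  espan c m (\prod_(i < m) z (c + i)%N ^+ a i).
Proof.
elim: m c a => [|m IH] c a am; first by rewrite big_ord0; exists 1.
rewrite big_ord_recl addn0; apply: espan_mulX; last exact: am.
under eq_bigr => i _ do rewrite /= /bump add1n -addSnnS.
by apply: (IH c.+1 (a \o succn)) => i im; apply: am.
Qed.

(** The factor [h] collects the elementary polynomials already split off, the one in most variables
    first. *)
Lemma espan_ind (S : A -> Prop) c m h f :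
  S 0 -> (forall f g, S f -> S g -> S (f - g)) ->
  (forall p : nat -> nat, (forall i, p i <= i.+1)%N ->
    S (h * \prod_(i < m) (esym c i.+1)`_(p i))) ->
  espan c m f -> S (h * f).
Proof.
move=> S0 SB.
have SD f1 f2 : S f1 -> S f2 -> S (f1 + f2).
  by move=> h1 h2; rewrite -[f2]opprK; apply: (SB) => //; rewrite -sub0r; apply: SB.
elim: m h f => [|m IH] h f Sp.
  case=> s ->; have Sh : S h by have := Sp (fun=> 0%N); rewrite big_ord0 mulr1; apply.
  have Sn k : S (h * k%:R).
    by elim: k => [|k IHk]; rewrite ?mulr0 // mulrSr mulrDr mulr1; apply: SD.
  by case: s => k; rewrite ?NegzE ?mulrNz -?pmulrn // mulrN -sub0r; apply: SB.
case=> g hg ->; rewrite mulr_sumr; elim/big_ind: _ => // q _.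
rewrite mulrCA mulrC; apply: IH (hg q) => p hp.
(* The bound on [p] is imposed at every index, so the sequence is extended by [q] at [m] and by 0
   beyond. *)
have := Sp (fun i => if (i < m)%N then p i else if i == m then val q else 0%N).
rewrite big_ord_recr /= ltnn eqxx.
have -> : \prod_(i < m) (esym c i.+1)`_(if (i < m)%N then p i else if i == m :> nat then val q else 0%N) =
    \prod_(i < m) (esym c i.+1)`_(p i) by apply: eq_bigr => i _; rewrite ltn_ord.
rewrite mulrA mulrAC; apply => i; case: ifP => // _; case: eqP => // ->.
by rewrite -ltnS.
Qed.

End ElementarySpan.

Lemma map_coef_esym (R S : comNzRingType) (h : {rmorphism R -> S}) (z : nat -> R)
    (z' : nat -> S) c k p : (forall j, h (z j) = z' j) ->
  h (esym z c k)`_p = (esym z' c k)`_p.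
Proof.
move=> zz'; rewrite -coef_map /esym rmorph_prod; congr (nth 0 (polyseq _) _).
by apply: eq_bigr => i _; rewrite rmorphD rmorphM rmorph1 /= map_polyC map_polyX -zz'.
Qed.

Lemma prod_esym (R : comNzRingType) (z : nat -> R) k (a b : R) :
  \prod_(i < k) (a + z i * b) = \sum_(l < k.+1) (esym z 0 k)`_l * a ^+ (k - l) * b ^+ l.
Proof.
elim: k => [|k IH]; first by rewrite big_ord0 big_ord1 coef_esym0 !mulr1.
rewrite big_ord_recr /= {}IH mulrDr [RHS]big_ord_recl /= coef_esym0 mul1r subn0.
under [in RHS]eq_bigr do rewrite /bump add1n subSS coef_esymSr add0n 2!mulrDl.
rewrite big_split /= addrA; congr (_ + _); last first.
  rewrite mulr_suml; apply: eq_bigr => l _; rewrite exprS; ring.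
rewrite big_ord_recl big_ord_recr /= (coef_esym_gt z 0 (ltnSn k)) !mul0r addr0 mulrDl.
rewrite coef_esym0 !mul1r mulr1 subn0 exprSr mulr1; congr (_ + _).
rewrite mulr_suml; apply: eq_bigr => l _.
rewrite /bump add1n; have -> : (k - l = (k - l.+1).+1)%N by have := ltn_ord l; lia.
by rewrite (exprSr a); ring.
Qed.

Lemma prod_esym1 (R : comNzRingType) (z : nat -> R) k N (b : R) : (k < N)%N ->
  \prod_(i < k) (1 + z i * b) = \sum_(l < N) b ^+ l * (esym z 0 k)`_l.
Proof.
move=> kN; rewrite prod_esym (big_ord_widen _
  (fun l => (esym z 0 k)`_l * 1 ^+ (k - l) * b ^+ l) kN) big_mkcond /=.
apply: eq_bigr => l _; rewrite expr1n mulr1 mulrC.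
by case: ltnP => // kl; rewrite coef_esym_gt // mulr0.
Qed.

(* The coefficients of the substitution expressing the [e_j (1 - z)] through the
   [e_l (z)], for [k] variables. *)
Definition ecoef (k j l : nat) : int :=
  if (l <= j <= k)%N then (-1) ^+ l * ('C(k - l, j - l))%:R else 0.

Lemma coef_exp1DX (R : comNzRingType) d i : ((1 + 'X : {poly R}) ^+ d)`_i = ('C(d, i))%:R.
Proof.
elim: d i => [|d IH] i; first by rewrite expr0 coef1 bin0n.
rewrite exprSr mulrDr mulr1 coefD coefMX !IH.
by case: i => [|i]; rewrite ?bin0 ?addr0 //= binS natrD.
Qed.

(** Write [1 + (1 - z i) * 'X] as [(1 + 'X) + z i * (- 'X)] and expand the product by
    [prod_esym]. *)
Lemma coef_esym1B (R : comNzRingType) (z : nat -> R) k j N : (k < N)%N ->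
  (esym (fun i => 1 - z i) 0 k)`_j = \sum_(l < N) (esym z 0 k)`_l *~ ecoef k j l.
Proof.
move=> kN; have [kj|jk] := ltnP k j.
  by rewrite coef_esym_gt // big1 // => l _; rewrite /ecoef [(j <= k)%N]leqNgt kj andbF mulr0z.
have -> : esym (fun i => 1 - z i) 0 k = \prod_(i < k) ((1 + 'X) + (z i)%:P * (- 'X)).
  by apply: eq_bigr => i _; rewrite add0n polyCB; ring.
have -> : \prod_(i < k) (1 + 'X + (z i)%:P * - 'X) =
    \sum_(l < k.+1) ((esym z 0 k)`_l)%:P * (1 + 'X) ^+ (k - l) * (- 'X) ^+ l.
  by rewrite (prod_esym (fun i => (z i)%:P)); apply: eq_bigr => l _; rewrite (map_coef_esym (z' := fun i => (z i)%:P)).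
rewrite coef_sum (big_ord_widen _ (fun l => (((esym z 0 k)`_l)%:P * (1 + 'X) ^+ (k - l)
  * (- 'X) ^+ l)`_j) kN) big_mkcond /=; apply: eq_bigr => l _.
rewrite /ecoef jk andbT; case: (ltnP l k.+1) => lk; last first.
  by rewrite ifN ?mulr0z //; lia.
rewrite (exprNn 'X) mulrA coefMXn -mulrA coefCM [_ * _ ^+ l]mulrC.
case: (leqP l j) => lj; last by rewrite mulr0z.
rewrite -(rmorph1 polyC) -polyCN -rmorphXn coefCM coef_exp1DX -mulrzr.
by rewrite intrM rmorphXn /= rmorphN1 mulrz_nat.
Qed.

Lemma sum_sign_bin d : \sum_(s < d.+1) (-1) ^+ s * ('C(d, s))%:R = (d == 0%N)%:R :> int.
Proof.
have := exprDn (1 : int) (-1) d; rewrite subrr expr0n => ->.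
by apply: eq_bigr => s _; rewrite expr1n mul1r mulr_natr.
Qed.

(** Both sides are the trinomial coefficient of $k-i$ with parts $l-i$, $j-l$, $k-j$. *)
Lemma mul_bin_trinomial k i l j : (i <= l <= j)%N -> (j <= k)%N ->
  ('C(k - l, j - l) * 'C(k - i, l - i) = 'C(k - i, j - i) * 'C(j - i, l - i))%N.
Proof.
move=> /andP[il lj] jk.
have d1 : (k - l - (j - l) = k - j)%N by lia.
have d2 : (k - i - (l - i) = k - l)%N by lia.
have d3 : (k - i - (j - i) = k - j)%N by lia.
have d4 : (j - i - (l - i) = j - l)%N by lia.
have e1 : ('C(k - l, j - l) * ((j - l)`! * (k - j)`!) = (k - l)`!)%N.
  by rewrite -d1 bin_fact // leq_sub2r.
have e2 : ('C(k - i, l - i) * ((l - i)`! * (k - l)`!) = (k - i)`!)%N.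
  by rewrite -d2 bin_fact // leq_sub2r // (leq_trans lj).
have e3 : ('C(k - i, j - i) * ((j - i)`! * (k - j)`!) = (k - i)`!)%N.
  by rewrite -d3 bin_fact // leq_sub2r.
have e4 : ('C(j - i, l - i) * ((l - i)`! * (j - l)`!) = (j - i)`!)%N.
  by rewrite -d4 bin_fact // leq_sub2r.
have pos := fact_gt0.
have D0 : (0 < (l - i)`! * (j - l)`! * (k - j)`!)%N by rewrite !muln_gt0 !pos.
apply/eqP; rewrite -(eqn_pmul2r D0); apply/eqP.
transitivity ((k - i)`!); first by rewrite -e2 -e1; ring.
by rewrite -e3 -e4; ring.
Qed.

(** This reflects the involution $z\mapsto 1-z$. Only $i\le l\le j$ contributes; the trinomial
    identity takes out a binomial coefficient and leaves the alternating sum [sum_sign_bin]. *)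
Lemma ecoef_inv k j i N : (j <= k < N)%N ->
  \sum_(l < N) ecoef k j l * ecoef k l i = (i == j)%:R.
Proof.
move=> /andP[jk kN]; have [ij|ji] := leqP i j; last first.
  rewrite big1 => [|l _]; first by rewrite gtn_eqF.
  by rewrite /ecoef; case: ifP => h1; case: ifP => h2; rewrite ?mul0r ?mulr0 //; lia.
rewrite -(big_mkord xpredT (fun l => ecoef k j l * ecoef k l i)).
rewrite (@big_cat_nat _ _ _ i) //=; last by lia.
rewrite big_nat big1 ?add0r => [|l /andP[_ li]]; last first.
  by rewrite {2}/ecoef ifN ?mulr0 //; lia.
rewrite (@big_cat_nat _ _ _ j.+1) //=; [|lia|lia].
rewrite [X in _ + X]big_nat [X in _ + X]big1 ?addr0 => [|l /andP[jl _]]; last first.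
  by rewrite /ecoef ifN ?mul0r //; lia.
rewrite -{1}[i]add0n big_addn big_mkord subSn //.
transitivity (('C(k - i, j - i))%:R * \sum_(s < (j - i).+1) (-1) ^+ s * ('C(j - i, s))%:R : int).
  rewrite mulr_sumr; apply: eq_bigr => s _; have := ltn_ord s; rewrite ltnS => sj.
  rewrite /ecoef !ifT; try lia.
  have := @mul_bin_trinomial k i (s + i) j; rewrite addnK => /(_ _ jk) e.
  rewrite mulrACA -exprD -addnA exprD addnn -mul2n exprM sqrrN !expr1n mulr1 -natrM e; last by lia.
  by rewrite natrM; ring.
rewrite sum_sign_bin subn_eq0; case: (leqP j i) => ji; last by rewrite mulr0 ltn_eqF.
have -> : i = j by lia.
by rewrite subnn bin0 mulr1 eqxx.
Qed.

(** * The quantization map *)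

Lemma esym_subsets (n : nat) (A : comNzRingType) (x : 'I_n.-1 -> A) (z : nat -> A) k p :
  (forall i : 'I_n.-1, z i = x i) -> (k <= n.-1)%N ->
  (esym z 0 k)`_p = \sum_(I | @ksubset n k p I) \prod_(i in I) x i.
Proof.
move=> zx kn; rewrite /esym (big_ord_widen _ (fun i => 1 + (z (0 + i)%N)%:P * 'X) kn) big_mkcond /=.
(* An index outside the first [k] gives the factor [0 + 1], so the expansion keeps only subsets of
   the first [k]. *)
rewrite (eq_bigr (fun i : 'I_n.-1 => (if (i < k)%N then (x i)%:P * 'X else 0) + 1)); last first.
  by move=> i _; rewrite add0n zx; case: ifP; rewrite ?add0r // addrC.
rewrite bigA_distr coef_sum (bigID (@ksubset n k p)) /= [X in _ + X]big1 ?addr0.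
  apply: eq_bigr => J /andP[/subsetP Jk /eqP Jp].
  rewrite -big_mkcond /= (eq_bigr (fun i => (x i)%:P * 'X)) => [|i /Jk]; last by rewrite inE => ->.
  by rewrite big_split /= prodr_const -rmorph_prod /= coefCM coefXn Jp eqxx mulr1.
move=> J; rewrite /ksubset negb_and -big_mkcond /=; have [Jk /=|] := boolP (J \subset _).
  move=> Jp; rewrite (eq_bigr (fun i => (x i)%:P * 'X)) => [|i /(subsetP Jk)]; last first.
    by rewrite inE => ->.
  by rewrite big_split /= prodr_const -rmorph_prod /= coefCM coefXn eq_sym (negbTE Jp) mulr0.
case/subsetPn => i iJ; rewrite inE => /negbTE ik _.
by rewrite (bigD1 i) //= ik mul0r coef0.
Qed.

Section Quantization.
Variable n : nat.
Implicit Types (k p j l : nat) (i : 'I_n.-1).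

(** [esym] takes variables indexed by [nat]. The default 0 starts at index [n.-1], beyond the range
    of [esym _ 0 k] for [k <= n.-1]. *)
Definition xvar (R : nzRingType) (j : nat) : {mpoly R[n]} :=
  oapp (fun i : 'I_n.-1 => 'X_(lo i)) 0 (insub j).

Lemma xvarE (R : nzRingType) i : xvar R i = 'X_(lo i).
Proof. by rewrite /xvar valK. Qed.

Lemma elsymE k p : (k <= n.-1)%N -> elsym n k p = (esym (@xvar (Zq n)) 0 k)`_p.
Proof. by move=> kn; rewrite (esym_subsets _ (@xvarE _)). Qed.

Lemma ksubset_gt k p (I : {set 'I_n.-1}) : (k <= n.-1)%N -> (k < p)%N -> ~~ @ksubset n k p I.
Proof.
move=> kn kp; apply/negP => /andP[/subset_leq_card le /eqP e]; move: le.
by rewrite e cardsE -sum1_card -(big_ord_widen _ (fun=> 1%N) kn) sum1_card card_ord leqNgt kp.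
Qed.

Lemma qF_gt k j : (k <= n.-1)%N -> (k < j)%N -> qF n k j = 0.
Proof. by move=> kn kj; rewrite /qF big_pred0 // => I; apply/negbTE/ksubset_gt. Qed.

(** For [l <= k], [qE n k l] is the combination of the [qF n k i] with coefficients [ecoef k l i];
    [ecoef_inv] inverts it. *)
Lemma qF_qE k j : (k <= n.-1)%N ->
  qF n k j = \sum_(l < n.+1) qE n k l *~ ecoef k j l.
Proof.
move=> kn; have kn1 : (k < n.+1)%N by lia.
have [kj|jk] := ltnP k j.
  by rewrite qF_gt // big1 // => l _; rewrite /ecoef [(j <= k)%N]leqNgt kj andbF mulr0z.
transitivity (\sum_(l < n.+1) \sum_(i < n.+1) qF n k i *~ (ecoef k j l * ecoef k l i)).
  rewrite exchange_big /= (bigD1 (inord j)) //= [X in _ + X]big1 => [|i ij].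
    rewrite addr0 inordK ?(leq_ltn_trans jk) //.
    by rewrite -[LHS]mulr1z -mulrz_sumr ecoef_inv ?jk // eqxx.
  rewrite -mulrz_sumr ecoef_inv ?jk // (_ : (i == j :> nat) = false) ?mulr0z //.
  by apply: contraNF ij => /eqP <-; rewrite inord_val.
apply: eq_bigr => l _.
have [lk|kl] := leqP l k; last first.
  have -> : ecoef k j l = 0 by rewrite /ecoef ifN //; lia.
  by rewrite mulr0z big1 // => i _; rewrite mul0r mulr0z.
under eq_bigr do rewrite mulrC mulrzA.
rewrite -mulrz_suml; congr (_ *~ _).
rewrite /qE (big_ord_widen _ (fun i : nat => (-1) ^+ i * ('C(k - i, l - i))%:R * qF n k i) (ltn_ord l)).
rewrite [RHS]big_mkcond /=; apply: eq_bigr => i _.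
rewrite /ecoef lk andbT; case: ltnP => il; last by rewrite ifN ?mulr0z // -ltnNge.
by rewrite -ltnS il -mulrzr intrM rmorphXn /= rmorphN1 mulrz_nat mulrC.
Qed.

(** One index type for the $e$-products and for the monomials of $L_n$, which makes the transition
    matrices square. *)
Definition exps := {dffun forall i : 'I_n.-1, 'I_i.+2}.

Implicit Types s t : exps.

Definition to_exps (p : 'I_n.-1 -> nat) : exps :=
  finfun (fun i : 'I_n.-1 => inord (p i) : 'I_i.+2).

Lemma to_expsE (p : 'I_n.-1 -> nat) i : (p i <= i.+1)%N -> to_exps p i = p i :> nat.
Proof. by move=> h; rewrite /to_exps ffunE inordK. Qed.

Definition eprod t : Zqx n := \prod_(i < n.-1) elsym n i.+1 (t i).
Definition qeprod t : Zqx n := \prod_(i < n.-1) qE n i.+1 (t i).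
(** The reversal matches [t i <= i.+1] with the bound [stair] at [lo (rev_ord i)]. *)
Definition mexp t : 'X_{1..n} := (\sum_(i < n.-1) U_(lo (rev_ord i)) *+ t i)%MM.

Lemma mexpX (R : nzRingType) t :
  'X_[mexp t] = \prod_(i < n.-1) 'X_(lo (rev_ord i)) ^+ t i :> {mpoly R[n]}.
Proof.
rewrite /mexp (big_morph _ (@mpolyXD n R) (@mpolyX0 n R)).
by apply: eq_bigr => i _; rewrite mpolyXn.
Qed.

Lemma mexp_inj : injective mexp.
Proof.
have e t i : mexp t (lo (rev_ord i)) = t i.
  rewrite /mexp mnm_sumE (bigD1 i) //= big1 => [|j ji].
    by rewrite addn0 mulmnE mnm1E eqxx mul1n.
  rewrite mulmnE mnm1E; case: eqP => // /(congr1 val) /= h.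
  by case/eqP: ji; apply: val_inj; have := ltn_ord i; have := ltn_ord j; rewrite /=; lia.
by move=> s t st; apply/ffunP => i; apply: val_inj; rewrite /= -!e st.
Qed.

Lemma monomial_eprod t : exists B : exps -> int,
  'X_[mexp t] = \sum_s eprod s *~ B s.
Proof.
pose S (f : Zqx n) := exists B : exps -> int, f = \sum_s eprod s *~ B s.
pose a j := oapp (fun i : 'I_n.-1 => val (t (rev_ord i))) 0%N (insub j).
rewrite -/(S _) -['X_[_]]mul1r; apply: (@espan_ind _ (@xvar (Zq n)) S 0 n.-1).
- by exists (fun=> 0); rewrite big1 // => s _; rewrite mulr0z.
- move=> f g [B ->] [C ->]; exists (fun s => B s - C s).
  by rewrite -sumrB; apply: eq_bigr => s _; rewrite mulrzBr.
- move=> p hp; pose s := to_exps (fun i => p i).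
  exists (fun u => (u == s)%:R); rewrite mul1r (bigD1 s) //= eqxx mulr1z [X in _ + X]big1 ?addr0.
    by rewrite /eprod; apply: eq_bigr => i _; rewrite to_expsE // elsymE.
  by move=> u /negbTE ->; rewrite mulr0z.
have -> : 'X_[mexp t] = \prod_(i < n.-1) xvar (Zq n) (0 + i) ^+ a i.
  rewrite mexpX (reindex_inj rev_ord_inj); apply: eq_bigr => i _.
  by rewrite rev_ordK add0n xvarE /a valK.
apply: espan_monomial => i im; rewrite /a (insubT (fun i : nat => (i < n.-1)%N) im) /=.
have le : (t (rev_ord (Ordinal im)) <= (rev_ord (Ordinal im)).+1)%N.
  by rewrite -ltnS; apply: ltn_ord.
by apply: leq_trans le _; rewrite /=; lia.
Qed.

(** [MB] writes monomials in $e$-products and [MA] writes $e$-products in monomials. Comparing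
    coefficients gives [MB *m MA = 1%:M]; for square matrices the other order follows, and it gives
    the values of [Q] on the $e$-products. *)
Lemma quantization_ex : exists Q, @is_quantization n Q.
Proof.
have [B BP] := fin_all_exists monomial_eprod.
pose T := #|exps|; pose b (i : 'I_T) : exps := enum_val i.
pose MB : 'M[Zq n]_T := \matrix_(i, j) (B (b i) (b j))%:~R.
pose MA : 'M[Zq n]_T := \matrix_(i, j) (eprod (b i))@_(mexp (b j)).
have BA : MB *m MA = 1%:M.
  apply/matrixP => i j; rewrite !mxE.
  have := congr1 (mcoeff (mexp (b j))) (BP (b i)).
  rewrite mcoeffX (inj_eq mexp_inj) (inj_eq enum_val_inj) raddf_sum /= => ->.
  rewrite (big_enum_val (A := exps) (fun s => (eprod s *~ B (b i) s)@_(mexp (b j)))).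
  by apply: eq_bigr => k _; rewrite !mxE raddfMz mulrzl.
have AB := mulmx1C BA.
(* In the expansion of each monomial [mexp t], [eprod s] is replaced by [qeprod s]; all other
   monomials are dropped. *)
pose Q (f : Zqx n) := \sum_t f@_(mexp t) *: \sum_s qeprod s *~ B t s.
exists Q; split.
  move=> c f g _ _; rewrite /Q scaler_sumr -big_split /=; apply: eq_bigr => t _.
  by rewrite mcoeffD mcoeffZ scalerDl scalerA.
move=> p hp; pose s := to_exps p.
have sp i : s i = p i :> nat by rewrite to_expsE.
have -> : \prod_(i < n.-1) elsym n i.+1 (p i) = eprod s by rewrite /eprod; apply: eq_bigr => i _; rewrite sp.
have -> : \prod_(i < n.-1) qE n i.+1 (p i) = qeprod s by rewrite /qeprod; apply: eq_bigr => i _; rewrite sp.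
rewrite /Q; under eq_bigr do rewrite scaler_sumr.
rewrite exchange_big /=.
transitivity (\sum_u (u == s)%:R *: qeprod u); last first.
  by rewrite (bigD1 s) //= eqxx scale1r big1 ?addr0 // => u /negbTE ->; rewrite scale0r.
apply: eq_bigr => u _.
under eq_bigr do rewrite -scaler_int scalerA.
rewrite -scaler_suml; congr (_ *: _).
have /matrixP/(_ (enum_rank s) (enum_rank u)) := AB.
rewrite !mxE (inj_eq enum_rank_inj) eq_sym => <-.
rewrite (big_enum_val (A := exps)); apply: eq_bigr => k _.
by rewrite !mxE /b !enum_rankK.
Qed.

Lemma QhatP : is_quantization (@Qhat n).
Proof. exact: epsilon_spec quantization_ex. Qed.

End Quantization.

(** * Quantizing the Cauchy identity *)

Section Assembly.
Variable n : nat.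
Implicit Types (i : 'I_n.-1) (j k l : nat) (m : 'X_{1..n}).

(** Inner sums are padded by vanishing terms to the common range [n.+1], so that products of sums
    distribute over one type of functions. *)
Local Notation indices := {ffun 'I_n.-1 -> 'I_n.+1}.

Lemma prod_mulrz (R : comNzRingType) (I : finType) (F : I -> R) (c : I -> int) :
  \prod_i (F i *~ c i) = (\prod_i F i) *~ \prod_i c i.
Proof.
under eq_bigr do rewrite -mulrzr.
by rewrite big_split /= -rmorph_prod mulrzr.
Qed.

(** The variable of index [j] occurs, with exponent at most one, only in the factors with
    [j < i.+1]. *)
Lemma mbound_elsym_prod (p : 'I_n.-1 -> nat) :
  mbound (@stair n) (\prod_(i < n.-1) elsym n i.+1 (p i)).
Proof.
apply: (@mbound_le _ _ (fun j : 'I_n => \sum_(i < n.-1) (j < i.+1))%N) => [j|]; last first.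
  apply: mbound_prod => i _; apply: mbound_sum => I /andP[/subsetP Ii _].
  apply: (@mbound_le _ _ (fun j : 'I_n => \sum_(i in I) (lo i == j))%N) => [j|]; last first.
    by apply: mbound_prod => k _; apply: mboundX.
  have [jn|jn] := ltnP j n.-1; last first.
    rewrite big1 // => k _; case: eqP => // e.
    by move: jn; rewrite -e /= leqNgt ltn_ord.
  have loE (k : 'I_n.-1) : (lo k == j) = (k == Ordinal jn) by rewrite -!val_eqE.
  under eq_bigr do rewrite loE.
  have [jI|jI] := boolP (Ordinal jn \in I).
    rewrite (bigD1 _ jI) /= eqxx big1 => [|k /andP[_ /negbTE ->]//].
    by have := Ii _ jI; rewrite inE /= => ->.
  by rewrite big1 // => k kI; case: eqP => // e; rewrite e (negbTE jI) in kI.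
have -> : stair j = (n.-1 - j)%N by rewrite /stair; case: (n) j => [[]|].
elim: n.-1 => [|N IH]; first by rewrite big_ord0.
rewrite big_ord_recr /=; apply: leq_trans (leq_add IH (leqnn _)) _.
by case: ltnP => /= jN; lia.
Qed.

Lemma Qhat_sum (I : finType) (F : I -> Zqx n) (c : I -> int) :
  (forall t, in_Lq (F t)) -> Qhat (\sum_t F t *~ c t) = \sum_t Qhat (F t) *~ c t.
Proof.
move=> hF; have [Qlin _] := @QhatP n.
have Q0 : Qhat (0 : Zqx n) = 0.
  have := Qlin 1 0 0 (@mbound0 _ _ (@stair n)) (@mbound0 _ _ (@stair n)).
  rewrite !scale1r addr0 => /eqP; rewrite -subr_eq0 opprD addNKr oppr_eq0 => /eqP; exact.
(* Linearity holds only inside $L_n^q$, so membership of the partial sums is carried along. *)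
have h (r : seq I) : in_Lq (\sum_(t <- r) F t *~ c t) /\
    Qhat (\sum_(t <- r) F t *~ c t) = \sum_(t <- r) Qhat (F t) *~ c t.
  elim: r => [|t r [L e]]; first by rewrite !big_nil; split=> //; apply: mbound0.
  rewrite !big_cons -scaler_int; split; last by rewrite Qlin // e scaler_int.
  by apply: mboundD => //; apply: mboundZ; apply: hF.
by have [] := h (index_enum I).
Qed.

Lemma Qhat_prod (p : 'I_n.-1 -> nat) :
  let E := \prod_(i < n.-1) \sum_(l < n.+1) elsym n i.+1 l *~ ecoef i.+1 (p i) l in
  in_Lq E /\ Qhat E = \prod_(i < n.-1) qF n i.+1 (p i).
Proof.
move=> E; pose C (t : indices) := \prod_(i < n.-1) ecoef i.+1 (p i) (t i).
have EE : E = \sum_(t : indices) (\prod_(i < n.-1) elsym n i.+1 (t i)) *~ C t.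
  by rewrite /E bigA_distr_bigA; apply: eq_bigr => t _; rewrite prod_mulrz.
have L (t : indices) : in_Lq (\prod_(i < n.-1) elsym n i.+1 (t i)).
  exact: (@mbound_elsym_prod (fun i => t i)).
split; first by rewrite EE; apply: mbound_sum => t _; rewrite -scaler_int; apply: mboundZ; exact: L.
rewrite EE Qhat_sum //.
transitivity (\sum_(t : indices) (\prod_(i < n.-1) qE n i.+1 (t i)) *~ C t).
  apply: eq_bigr => t _; have [tb|] := boolP [forall i, t i <= i.+1]%N.
    have [_ Qprod] := @QhatP n.
    by rewrite (Qprod (fun i => t i)) // => i; apply: (forallP tb).
  (* [is_quantization] does not cover these index functions, but [ecoef] makes their coefficients
     vanish. *)
  rewrite negb_forall => /existsP[i ti].
  have -> : C t = 0; last by rewrite !mulr0z.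
  rewrite /C (bigD1 i) //= /ecoef ifN ?mul0r //.
  by apply: contra ti => /andP[]; apply: leq_trans.
under eq_bigr do rewrite -prod_mulrz.
rewrite -(bigA_distr_bigA (fun i (l : 'I_n.+1) => qE n i.+1 l *~ ecoef i.+1 (p i) l)).
by apply: eq_bigr => i _; rewrite qF_qE.
Qed.

Definition xmon (t : indices) : {mpoly int[n]} :=
  \prod_(i < n.-1) (- (1 - 'X_(lo (rev_ord i)))) ^+ t i.

(** The integers [(xmon t)@_m] do not depend on [R], so one combination serves both for the
    classical kernel and for [qdgroth_w0]. *)
Lemma coef_prod_sum (R : comNzRingType) (g : 'I_n.-1 -> nat -> R) m :
  (\prod_(i < n.-1) \sum_(j < n.+1)
     (- (1 - 'X_(lo (rev_ord i)))) ^+ j * (g i j)%:MP)@_m =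
  \sum_(t : indices) (\prod_(i < n.-1) g i (t i)) *~ (xmon t)@_m.
Proof.
rewrite bigA_distr_bigA raddf_sum; apply: eq_bigr => t _.
rewrite big_split /= -rmorph_prod /= mulrC mcoeffCM -mulrzr; congr (_ * _).
have -> : \prod_(i < n.-1) (- (1 - 'X_(lo (rev_ord i)))) ^+ t i =
    map_mpoly (intr : int -> R) (xmon t).
  rewrite /xmon rmorph_prod; apply: eq_bigr => i _.
  by rewrite rmorphXn rmorphN rmorphB rmorph1 /= map_mpolyX.
by rewrite mcoeff_map_mpoly.
Qed.

Definition yvar j : {mpoly int[n]} := 1 - xvar n int j.

Lemma xvar_ord (R : nzRingType) (y : 'I_n) : (y < n.-1)%N -> xvar n R y = 'X_y.
Proof.
move=> yn; rewrite (_ : val y = Ordinal yn) // xvarE.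
by congr ('X_ _); apply: val_inj.
Qed.

Lemma cauchy_kernel_prod : cauchy_kernel n =
  \prod_(i < n.-1) \sum_(j < n.+1)
     (- (1 - 'X_(lo (rev_ord i)))) ^+ j * ((esym yvar 0 i.+1)`_j)%:MP.
Proof.
rewrite /cauchy_kernel (eq_bigl (fun p => true && @below_diag n (p.1, p.2))); last by case.
rewrite (eq_bigr (fun p => @cauchy_factor n (p.1, p.2))); last by case.
rewrite -(pair_big_dep xpredT (fun x y : 'I_n => below_diag (x, y)) (fun x y => @cauchy_factor n (x, y))) /=.
transitivity (\prod_(i < n.-1) \prod_(y | below_diag (lo i, y)) @cauchy_factor n (lo i, y)).
  rewrite (bigID (fun x : 'I_n => (x < n.-1)%N)) /= [X in _ * X]big1 ?mulr1.
    exact: (big_ord_narrow (leq_pred n)).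
  move=> x xn; rewrite big_pred0 // => y; rewrite /below_diag /=; lia.
(* After reversal, the row of [lo (rev_ord i)] has [i.+1] cells. *)
rewrite (reindex_inj rev_ord_inj); apply: eq_bigr => i _.
transitivity (\prod_(y < i.+1) (1 + (yvar y)%:MP * (- (1 - 'X_(lo (rev_ord i)))))).
  have le : (i.+1 <= n)%N by have := ltn_ord i; lia.
  rewrite (big_ord_widen _ (fun y => 1 + (yvar y)%:MP * (- (1 - 'X_(lo (rev_ord i))))) le).
  apply: eq_big => [y|y]; first by rewrite /below_diag /=; have := ltn_ord i; lia.
  rewrite /below_diag /= => yi; rewrite /cauchy_factor /yvar xvar_ord /=.
    by rewrite mulrN mulrC.
  by have := ltn_ord i; lia.
have le : (i.+1 < n.+1)%N by have := ltn_ord i; lia.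
rewrite (prod_esym1 (fun y => (yvar y)%:MP) _ le); apply: eq_bigr => l _; congr (_ * _).
by apply: Logic.eq_sym; apply: map_coef_esym.
Qed.

Lemma alt_sum_pad (R : pzRingType) (u : R) (v : nat -> R) k N :
  v 0%N = 1 -> (forall j, (k < j)%N -> v j = 0) -> (k < N)%N ->
  1 + \sum_(1 <= j < k.+1) (-1) ^+ j * u ^+ j * v j = \sum_(j < N) (- u) ^+ j * v j.
Proof.
move=> v0 vk kN.
transitivity (\sum_(j < k.+1) (- u) ^+ j * v j).
  rewrite -(big_mkord xpredT (fun j => (- u) ^+ j * v j)) [RHS]big_ltn // v0 mulr1 expr0.
  by congr (_ + _); apply: eq_bigr => j _; rewrite [in RHS]exprNn.
rewrite (big_ord_widen _ (fun j => (- u) ^+ j * v j) kN) big_mkcond /=.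
by apply: eq_bigr => j _; case: ltnP => // kj; rewrite vk ?mulr0.
Qed.

Lemma qdgroth_prod : qdgroth_w0 n =
  \prod_(i < n.-1) \sum_(j < n.+1)
     (- (1 - 'X_(lo (rev_ord i)))) ^+ j * (qF n i.+1 j)%:MP.
Proof.
apply: eq_bigr => i _; apply: (@alt_sum_pad _ _ (fun j => (qF n i.+1 j)%:MP)).
- by rewrite qF0.
- by move=> j ij; rewrite qF_gt.
by have := ltn_ord i; lia.
Qed.

Lemma map_xvar (R S : nzRingType) (h : {rmorphism R -> S}) j :
  map_mpoly h (xvar n R j) = xvar n S j.
Proof. by rewrite /xvar; case: insub => [i|] /=; rewrite ?map_mpolyX ?raddf0. Qed.

Lemma map_esym_yvar i j :
  map_mpoly (intr : int -> Zq n) (esym yvar 0 i.+1)`_j =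
  \sum_(l < n.+1) elsym n i.+1 l *~ ecoef i.+1 j l.
Proof.
have iN : (i.+1 < n.+1)%N by have := ltn_ord i; lia.
rewrite (coef_esym1B (xvar n int) j iN) raddf_sum; apply: eq_bigr => l _.
have e : map_mpoly (intr : int -> Zq n) (esym (xvar n int) 0 i.+1)`_l = elsym n i.+1 l.
  rewrite (@elsymE n i.+1 l (ltn_ord i)); apply: map_coef_esym => y; apply: map_xvar.
by rewrite raddfMz /= e.
Qed.

End Assembly.

Theorem theorem8p6 (n : nat) (hn : (1 <= n)%N) :
  qdgroth_w0 n =
  \sum_(w : 'S_n)
     map_mpoly (intr : int -> Zqx n) (dual_groth w) * (qgroth (w \oP w0 n))%:MP.
Proof.
apply/mpolyP => m; rewrite qdgroth_prod (coef_prod_sum (fun i j => qF n i.+1 j)).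
pose emb (f : {mpoly int[n]}) : Zqx n := map_mpoly (intr : int -> Zq n) f.
have embE t : emb (\prod_(i < n.-1) (esym (yvar n) 0 i.+1)`_(t i)) =
    \prod_(i < n.-1) \sum_(l < n.+1) elsym n i.+1 l *~ ecoef i.+1 (t i) l.
  by rewrite /emb rmorph_prod /=; apply: eq_bigr => i _; rewrite map_esym_yvar.
have embS (I : finType) (F : I -> {mpoly int[n]}) (c : I -> int) :
    emb (\sum_t F t *~ c t) = \sum_t emb (F t) *~ c t.
  by rewrite /emb raddf_sum; apply: eq_bigr => t _; rewrite raddfMz.
(* Both $x$-coefficients are the same integer combination, so [Qhat] has only to send the products
   of the $e_j(1-y)$ to those of the $F_j(y)$. *)
transitivity (Qhat (emb (cauchy_kernel n)@_m)).
  rewrite cauchy_kernel_prod (coef_prod_sum (fun i j => (esym (yvar n) 0 i.+1)`_j)) embS.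
  rewrite Qhat_sum => [|t]; last by rewrite embE; apply: (Qhat_prod (fun i => t i)).1.
  by apply: eq_bigr => t _; rewrite embE (Qhat_prod (fun i => t i)).2.
rewrite cauchy_identity embS.
rewrite Qhat_sum => [|w]; last by apply: mbound_map; apply: mbound_groth.
rewrite raddf_sum /=; apply: eq_bigr => w _.
by rewrite (mulrC (map_mpoly _ _)) mcoeffCM mcoeff_map_mpoly mulrzr.
Qed.
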